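(* Let $\eta\in\mathbb{C}\setminus\{0\}$ and let $\beta_0,\beta_1,\beta_2\in\mathbb{C}$ satisfy $\beta_0+\beta_1+\beta_2=\frac12$. Consider an ordinary differential system $$\frac{dx}{dt}=f_1(x,y,z),\quad \frac{dy}{dt}=f_2(x,y,z),\quad \frac{dz}{dt}=f_3(x,y,z)$$ where $f_1,f_2,f_3$ are polynomials in $x,y,z$ with coefficients in $\mathbb{C}(t)$. Assume: (A1) $\deg(f_i)=6$ with respect to $x,y,z$ for $i=1,2,3$; (A2) the right-hand side of the system becomes again a polynomial in each of the coordinate systems $(x_i,y_i,z_i)$, $i=1,2,3$, where 1) $x_1=x-\eta,\ y_1=y-1,\ z_1=z-\frac{\beta_0(x+y-\eta-1)}{(x-\eta)(y-1)}$; 2) $x_2=x+\frac{\beta_1}{z},\ y_2=y+\frac{\beta_1}{z},\ z_2=z$; 3) $x_3=x,\ y_3=y,\ z_3=z-\frac{\beta_2(x+y)}{xy}$. Then the system coincides with the $D_4^{(1)}$ system (defined in the context), for some $b(t)\in\mathbb{C}(t)$, with the parameter relations $\alpha_4=\alpha_1$, $\alpha_0=\alpha_3$, $\beta_0=\alpha_3$, $\beta_1=\alpha_2$, $\beta_2=\alpha_1$.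
   Context: Condition (A2) means: for each $i$, when the system is rewritten in the coordinates $(x_i,y_i,z_i)$, the expressions for $dx_i/dt,dy_i/dt,dz_i/dt$ are polynomials in $x_i,y_i,z_i$ (with coefficients in $\mathbb{C}(t)$). The $D_4^{(1)}$ system. Let $\eta\in\mathbb{C}\setminus\{0\}$, let $b(t)\in\mathbb{C}(t)$ be nonzero, and let $\alpha_0,\dots,\alpha_4\in\mathbb{C}$ satisfy $\alpha_0+\alpha_1+2\alpha_2+\alpha_3+\alpha_4=1$. The $D_4^{(1)}$ system for unknown functions $x,y,z$ of $t$ is $$\frac{2\eta}{b(t)}\frac{dx}{dt}=P,\qquad -\frac{2\eta}{b(t)}\frac{dy}{dt}=Q,\qquad \frac{2\eta}{b(t)}\frac{dz}{dt}=R,$$ where $P=-2x(y-1)yz(x-\eta)(2x-2y+1-\eta)-2(2\alpha_0+2\alpha_1+4\alpha_2+\alpha_3+\alpha_4)x^3y-2(\alpha_0+\alpha_1)xy^3+(5\alpha_0+5\alpha_1+6\alpha_2+\alpha_3+\alpha_4)x^2y^2-\{5\alpha_0+5\alpha_1+6\alpha_2+2\alpha_3-3(2\alpha_0+2\alpha_1+4\alpha_2+\alpha_3+\alpha_4)\eta\}x^2y+\{3(\alpha_0+\alpha_1)-(4\alpha_0+6\alpha_1+6\alpha_2+\alpha_3+\alpha_4)\eta\}xy^2+x^4+2(\alpha_0+\alpha_1+2\alpha_2+\alpha_3-\eta)x^3+2\alpha_1\eta y^3+\{(\alpha_0+\alpha_1+2\alpha_2+\alpha_3)(\eta^2-3\eta+1)+\alpha_4\eta^2\}x^2+\alpha_1(\eta-3)\eta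 y^2+\{-(\alpha_0+\alpha_1)+2(2\alpha_0+3\alpha_1+3\alpha_2+\alpha_3)\eta-(2\alpha_0+2\alpha_1+4\alpha_2+\alpha_3+\alpha_4)\eta^2\}xy+(\alpha_0+\alpha_1+2\alpha_2+\alpha_3)(\eta-1)\eta x-\alpha_1(\eta-1)\eta y$, $Q=2x(y-1)yz(x-\eta)(2x-2y+1-\eta)-2(\alpha_3+\alpha_4)x^3y-2(\alpha_0+\alpha_1+4\alpha_2+2\alpha_3+2\alpha_4)xy^3+(\alpha_0+\alpha_1+6\alpha_2+5\alpha_3+5\alpha_4)x^2y^2+\{-(\alpha_0+\alpha_1+6\alpha_2+4\alpha_3+6\alpha_4)+3(\alpha_3+\alpha_4)\eta\}x^2y+\{3(\alpha_0+\alpha_1+4\alpha_2+2\alpha_3+2\alpha_4)-(2\alpha_0+6\alpha_2+5\alpha_3+5\alpha_4)\eta\}xy^2+y^4+2\alpha_4x^3+2\{(\alpha_0+2\alpha_2+\alpha_3+\alpha_4)\eta-1\}y^3-\alpha_4(3\eta-1)x^2+\{1-3(\alpha_0+2\alpha_2+\alpha_3+\alpha_4)\eta+(\alpha_0+2\alpha_2+\alpha_3+\alpha_4)\eta^2\}y^2+\{-(\alpha_0+\alpha_1+4\alpha_2+2\alpha_3+2\alpha_4)+2(\alpha_0+3\alpha_2+2\alpha_3+3\alpha_4)\eta-(\alpha_3+\alpha_4)\eta^2\}xy+\alpha_4(\eta-1)\eta x-(\alpha_0+2\alpha_2+\alpha_3+\alpha_4)(\eta-1)\eta y$, $R=(2x-2y+1-\eta)\{2x^2y+2xy^2-x^2-\eta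 y^2-2(\eta+1)xy+\eta(x+y)\}z^2+z\big[-2(\alpha_3+\alpha_4)x^3+2(\alpha_0+\alpha_1)y^3+2(\alpha_0+\alpha_1+6\alpha_2+2\alpha_3+2\alpha_4)x^2y-2(2\alpha_0+2\alpha_1+6\alpha_2+\alpha_3+\alpha_4)xy^2+\{-(\alpha_0+\alpha_1+6\alpha_2+4\alpha_3)+3(\alpha_3+\alpha_4)\eta\}x^2+\{-3(\alpha_0+\alpha_1)+(4\alpha_0+6\alpha_2+\alpha_3+\alpha_4)\eta\}y^2-4\{-(\alpha_0+\alpha_1+3\alpha_2+\alpha_3)+(\alpha_0+3\alpha_2+\alpha_3+\alpha_4)\eta\}xy+\{-(\alpha_0+\alpha_1+4\alpha_2+2\alpha_3)+2(\alpha_0+3\alpha_2+2\alpha_3)\eta-(\alpha_3+\alpha_4)\eta^2\}x+\{\alpha_0+\alpha_1-2(2\alpha_0+3\alpha_2+\alpha_3)\eta+(2\alpha_0+4\alpha_2+\alpha_3+\alpha_4)\eta^2\}y-(\alpha_0+2\alpha_2+\alpha_3)(\eta-1)\eta\big]+\alpha_2\big[(\alpha_0+\alpha_1+2\alpha_2-\alpha_3-\alpha_4)x^2+(\alpha_0+\alpha_1-2\alpha_2-\alpha_3-\alpha_4)y^2-2(\alpha_0+\alpha_1-\alpha_3-\alpha_4)xy+\{\alpha_0+\alpha_1-2\alpha_3-(2\alpha_0+2\alpha_2-\alpha_3-\alpha_4)\eta\}x+\{-\alpha_0-\alpha_1+2\alpha_2+2\alpha_3+(2\alpha_0-\alpha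_3-\alpha_4)\eta\}y+(\eta-1)(\alpha_2+\alpha_3+(\alpha_0+\alpha_2)\eta)\big]$.
   Formalization: The formal theorem additionally assumes η ≠ 1, η ≠ −1 and β_0, β_1, β_2 all nonzero; in each excluded case there are other systems satisfying (A1) and (A2), so the claim as printed fails there. *)

(* Defs.v *)
From HB Require Import structures.
From mathcomp Require Import all_boot all_order all_algebra.
From mathcomp Require Import mpoly complex reals ring.

Set Implicit Arguments.
Unset Strict Implicit.
Unset Printing Implicit Defensive.

Import GRing.Theory.

Local Open Scope ring_scope.

Local Notation "p %:F" := (tofrac p).

Section FractionDerivation.

Variable A : idomainType.

(* Quotient rule, extending a derivation of A to its field of fractions;
   by frac_derE the chosen representative of the fraction is irrelevant. *)
Definition frac_der (D : A -> A) (u : {fraction A}) : {fraction A} :=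
  let n := (frac (repr u)).1 in
  let d := (frac (repr u)).2 in
  (D n * d - n * D d)%:F / (d ^+ 2)%:F.

Lemma frac_reprE (u : {fraction A}) :
  u = (frac (repr u)).1%:F / (frac (repr u)).2%:F.
Proof.
rewrite -{1}[u]reprK; set r := repr u.
have d0 : (frac r).2 != 0 by exact: denom_ratioP.
unlock tofrac.
rewrite -[X in _ = _ * X]FracField.pi_inv -[RHS]FracField.pi_mul.
rewrite /FracField.mulf /FracField.invf !numden_Ratio ?oner_eq0 //.
by rewrite mulr1 mul1r Ratio_numden.
Qed.

Lemma frac_derE (D : A -> A) :
  (forall a b, D (a * b) = D a * b + a * D b) ->
  forall n d : A, d != 0 ->
  frac_der D (n%:F / d%:F) = (D n * d - n * D d)%:F / (d ^+ 2)%:F.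
Proof.
move=> DM n d d0; rewrite /frac_der.
have := frac_reprE (n%:F / d%:F).
set r := repr _; set n' := (frac r).1; set d' := (frac r).2 => r_def.
have d'0 : d' != 0 by exact: denom_ratioP.
have F0 (a : A) : a != 0 -> a%:F != 0 by rewrite tofrac_eq0.
have e : n * d' = n' * d.
  apply/eqP; rewrite -tofrac_eq !tofracM.
  by rewrite -eqr_div ?F0 // r_def.
apply/eqP; rewrite eqr_div ?F0 ?expf_neq0 // -!tofracM tofrac_eq; apply/eqP.
have De : D n * d' + n * D d' = D n' * d + n' * D d by rewrite -!DM e.
have -> : (D n' * d' - n' * D d') * d ^+ 2 =
  d' * d * (D n' * d + n' * D d) - (n' * d) * (d' * D d + d * D d') by ring.
by rewrite -De -e; ring.
Qed.
End FractionDerivation.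

Section Systems.

Variable R : realType.

Local Notation C := (complex R).

Definition Ct : fieldType := {fraction {poly C}}.

Definition Pxyz := {mpoly Ct[3]}.

Definition Fxyz : fieldType := {fraction Pxyz}.

Definition constT (c : C) : Ct := (c%:P)%:F.
Definition constP (c : C) : Pxyz := (constT c)%:MP.
Definition constF (c : C) : Fxyz := (constP c)%:F.

Definition vec3 (T : Type) (a b c : T) : 'I_3 -> T := tnth [tuple a; b; c].

Definition xP : Pxyz := 'X_(@Ordinal 3 0 isT).
Definition yP : Pxyz := 'X_(@Ordinal 3 1 isT).
Definition zP : Pxyz := 'X_(@Ordinal 3 2 isT).

Definition dCt (c : Ct) : Ct := frac_der (@deriv C) c.

(* Total derivative of p(t, x, y, z) along (dx/dt, dy/dt, dz/dt) = f:
   the partial derivative in t acts on the coefficients. *)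
Definition along (f : 'I_3 -> Pxyz) (p : Pxyz) : Pxyz :=
  map_mpoly dCt p + \sum_(i < 3) f i * p^`M(i).

Definition time_der (f : 'I_3 -> Pxyz) (u : Fxyz) : Fxyz :=
  frac_der (along f) u.

Definition subst3 (u : 'I_3 -> Fxyz) (g : Pxyz) : Fxyz :=
  mmap (fun c : Ct => (c%:MP : Pxyz)%:F) u g.

(* Each du_j/dt is a polynomial in u_0, u_1, u_2 over C(t); as u is a birational
   change of coordinates, this is the rewriting of the system in u. *)
Definition polynomial_in (f : 'I_3 -> Pxyz) (u : 'I_3 -> Fxyz) : Prop :=
  forall j : 'I_3, exists g : Pxyz, time_der f (u j) = subst3 u g.

Local Notation x := (xP%:F : Fxyz).
Local Notation y := (yP%:F : Fxyz).
Local Notation z := (zP%:F : Fxyz).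

Definition chart1 (eta b0 : C) : 'I_3 -> Fxyz :=
  vec3 (x - constF eta) (y - 1)
    (z - constF b0 * (x + y - constF eta - 1)
         / ((x - constF eta) * (y - 1))).

Definition chart2 (b1 : C) : 'I_3 -> Fxyz :=
  vec3 (x + constF b1 / z) (y + constF b1 / z) z.

Definition chart3 (b2 : C) : 'I_3 -> Fxyz :=
  vec3 x y (z - constF b2 * (x + y) / (x * y)).

End Systems.

Section D4Polynomials.

Variables (A : comNzRingType) (eta a0 a1 a2 a3 a4 x y z : A).

Definition D4_P : A :=
  - 2 * x * (y - 1) * y * z * (x - eta) * (2 * x - 2 * y + 1 - eta)
  - 2 * (2 * a0 + 2 * a1 + 4 * a2 + a3 + a4) * x ^+ 3 * y
  - 2 * (a0 + a1) * x * y ^+ 3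
  + (5 * a0 + 5 * a1 + 6 * a2 + a3 + a4) * x ^+ 2 * y ^+ 2
  - (5 * a0 + 5 * a1 + 6 * a2 + 2 * a3
      - 3 * (2 * a0 + 2 * a1 + 4 * a2 + a3 + a4) * eta) * x ^+ 2 * y
  + (3 * (a0 + a1) - (4 * a0 + 6 * a1 + 6 * a2 + a3 + a4) * eta) * x * y ^+ 2
  + x ^+ 4
  + 2 * (a0 + a1 + 2 * a2 + a3 - eta) * x ^+ 3
  + 2 * a1 * eta * y ^+ 3
  + ((a0 + a1 + 2 * a2 + a3) * (eta ^+ 2 - 3 * eta + 1)
      + a4 * eta ^+ 2) * x ^+ 2
  + a1 * (eta - 3) * eta * y ^+ 2
  + (- (a0 + a1) + 2 * (2 * a0 + 3 * a1 + 3 * a2 + a3) * eta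
      - (2 * a0 + 2 * a1 + 4 * a2 + a3 + a4) * eta ^+ 2) * x * y
  + (a0 + a1 + 2 * a2 + a3) * (eta - 1) * eta * x
  - a1 * (eta - 1) * eta * y.

Definition D4_Q : A :=
  2 * x * (y - 1) * y * z * (x - eta) * (2 * x - 2 * y + 1 - eta)
  - 2 * (a3 + a4) * x ^+ 3 * y
  - 2 * (a0 + a1 + 4 * a2 + 2 * a3 + 2 * a4) * x * y ^+ 3
  + (a0 + a1 + 6 * a2 + 5 * a3 + 5 * a4) * x ^+ 2 * y ^+ 2
  + (- (a0 + a1 + 6 * a2 + 4 * a3 + 6 * a4)
      + 3 * (a3 + a4) * eta) * x ^+ 2 * y
  + (3 * (a0 + a1 + 4 * a2 + 2 * a3 + 2 * a4)
      - (2 * a0 + 6 * a2 + 5 * a3 + 5 * a4) * eta) * x * y ^+ 2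
  + y ^+ 4
  + 2 * a4 * x ^+ 3
  + 2 * ((a0 + 2 * a2 + a3 + a4) * eta - 1) * y ^+ 3
  - a4 * (3 * eta - 1) * x ^+ 2
  + (1 - 3 * (a0 + 2 * a2 + a3 + a4) * eta
      + (a0 + 2 * a2 + a3 + a4) * eta ^+ 2) * y ^+ 2
  + (- (a0 + a1 + 4 * a2 + 2 * a3 + 2 * a4)
      + 2 * (a0 + 3 * a2 + 2 * a3 + 3 * a4) * eta
      - (a3 + a4) * eta ^+ 2) * x * y
  + a4 * (eta - 1) * eta * x
  - (a0 + 2 * a2 + a3 + a4) * (eta - 1) * eta * y.

Definition D4_R : A :=
  (2 * x - 2 * y + 1 - eta) * (2 * x ^+ 2 * y + 2 * x * y ^+ 2 - x ^+ 2
      - eta * y ^+ 2 - 2 * (eta + 1) * x * y + eta * (x + y)) * z ^+ 2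
  + z * (- 2 * (a3 + a4) * x ^+ 3 + 2 * (a0 + a1) * y ^+ 3
      + 2 * (a0 + a1 + 6 * a2 + 2 * a3 + 2 * a4) * x ^+ 2 * y
      - 2 * (2 * a0 + 2 * a1 + 6 * a2 + a3 + a4) * x * y ^+ 2
      + (- (a0 + a1 + 6 * a2 + 4 * a3) + 3 * (a3 + a4) * eta) * x ^+ 2
      + (- 3 * (a0 + a1) + (4 * a0 + 6 * a2 + a3 + a4) * eta) * y ^+ 2
      - 4 * (- (a0 + a1 + 3 * a2 + a3)
      + (a0 + 3 * a2 + a3 + a4) * eta) * x * y
      + (- (a0 + a1 + 4 * a2 + 2 * a3) + 2 * (a0 + 3 * a2 + 2 * a3) * eta
      - (a3 + a4) * eta ^+ 2) * x
      + (a0 + a1 - 2 * (2 * a0 + 3 * a2 + a3) * eta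
      + (2 * a0 + 4 * a2 + a3 + a4) * eta ^+ 2) * y
      - (a0 + 2 * a2 + a3) * (eta - 1) * eta)
  + a2 * ((a0 + a1 + 2 * a2 - a3 - a4) * x ^+ 2
      + (a0 + a1 - 2 * a2 - a3 - a4) * y ^+ 2
      - 2 * (a0 + a1 - a3 - a4) * x * y
      + (a0 + a1 - 2 * a3 - (2 * a0 + 2 * a2 - a3 - a4) * eta) * x
      + (- a0 - a1 + 2 * a2 + 2 * a3 + (2 * a0 - a3 - a4) * eta) * y
      + (eta - 1) * (a2 + a3 + (a0 + a2) * eta)).

End D4Polynomials.

Definition D4_system (R : realType) (eta : complex R) (b : Ct R)
    (a0 a1 a2 a3 a4 : complex R) (f1 f2 f3 : Pxyz R) : Prop :=
  let k := constT (2 * eta) / b in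
  let poly_of (F : Pxyz R -> Pxyz R -> Pxyz R -> Pxyz R -> Pxyz R -> Pxyz R ->
                   Pxyz R -> Pxyz R -> Pxyz R -> Pxyz R) :=
    F (constP eta) (constP a0) (constP a1) (constP a2) (constP a3) (constP a4)
      (xP R) (yP R) (zP R) in
  [/\ eta != 0, b != 0 & a0 + a1 + 2 * a2 + a3 + a4 = 1] /\
  [/\ k *: f1 = poly_of (@D4_P (Pxyz R)),
      - k *: f2 = poly_of (@D4_Q (Pxyz R))
    & k *: f3 = poly_of (@D4_R (Pxyz R))].

(* Main.v *)
Require Import Defs.
From HB Require Import structures.
From mathcomp Require Import all_boot all_order all_algebra polyXY.
From mathcomp Require Import mpoly complex reals ring zify.

(** Conditions (A1) and (A2) bound the degree of the right-hand side (f1, f2, f3)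
    and are linear in it. The proof shows that every solution is a multiple of
    the D_4^(1) field by an element of C(t).

    Reduction to a plane. The charts 1) and 3) only change z, by
    w (1/(x - e) + 1/(y - e')), and the chart 2) keeps z and x - y. Everything
    can therefore be seen on the generic plane x - y = d, where f1, f2, f3 become
    polynomials F1, F2, F3 in x and z of total degree at most 6 (slice). There
    the charts 1) and 3) say what happens at four poles x = 0, eta, d, d + 1,
    the traces of x = 0, x = eta, y = 0, y = 1: the components remain free of
    poles after z has been replaced with s + w / (x - c), where the component
    dz/dt must first be corrected by the derivative of w / (x - c). The chart 2)
    says the same with x and z exchanged, at z = 0.

    The planar problem. Write z = u / (x - c). Absence of poles for all s means
    that a polynomial in x - c and u has high multiplicity at the point (0, w)
    (blowup_dvd), so that its coefficient of (x - c)^n is divisible by a power of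
    u - w. Confronted with the bound 6 on the degree, these divisibilities bound
    the degrees in z and then determine the shape of the system
    (planar_normal_form): with q the product of the four x - c,
      F1 = A + l q z,   F2 = F1 - D,   F3 = B - A' z - (l / 2) q' z^2,
    where l and D are constants on the plane, A is a cubic in x with leading
    coefficient beta1 l and given values at the four poles, and B is affine in x
    and determined by A and l.

    Rigidity. A cubic with four given values has a given leading coefficient,
    and this is one relation (jump_relation):
      (2 d + 1 - eta) D = - (l / 2) d (d - eta) (d + 1) (d + 1 - eta).
    Now let d vary. Both l and D are polynomials in d, and l has degree at most
    1. If eta is neither 1 nor -1, the zero (eta - 1) / 2 of the factor of D is
    not a zero of the product on the right; so l vanishes there, and
    l = c (2 d + 1 - eta) with c in C(t) (rigidity). Then D, A and B are known
    too, and the system is the D_4^(1) system with b = - eta c; c is not zero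
    because f1 is not.

    The conditions (A2) are identities between fractions. They are used through
    the values of fractions at points with coordinates in an extension field
    (has_value), which avoids substitutions into rational functions. *)

Set Implicit Arguments.
Unset Strict Implicit.
Unset Printing Implicit Defensive.

Import GRing.Theory.
Local Open Scope ring_scope.

Local Notation "p %:F" := (tofrac p).
Local Notation i0 := (@Ordinal 3 0 isT).
Local Notation i1 := (@Ordinal 3 1 isT).
Local Notation i2 := (@Ordinal 3 2 isT).

(** * Pole cancellation and multiplicities *)

Section PolesAndMultiplicities.
Variable k : fieldType.
Implicit Types (p q N G : {poly k}) (c x : k) (h : k -> k).

(** The function h is given near c, outside c itself, by a rational function
    without pole at c; the zeros of the denominator N are exempted so that the
    notion is local at c. *)
Definition regular_at c h := exists N G : {poly k},
  N.[c] != 0 /\ forall x, x != c -> N.[x] != 0 -> h x = G.[x] / N.[x].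

Lemma regular_near N c h h' : N.[c] != 0 ->
  (forall x, x != c -> N.[x] != 0 -> h x = h' x) ->
  regular_at c h' -> regular_at c h.
Proof.
move=> Nc hh' [N' [G [N'c h'E]]]; exists (N' * N), (G * N).
split=> [|x xc]; rewrite !hornerE; first by rewrite mulf_neq0.
rewrite mulf_eq0 => /norP[N'x Nx].
by rewrite hh' // h'E // invfM mulrACA mulfV // mulr1.
Qed.

Lemma regular_poly c p : regular_at c (fun x => p.[x]).
Proof. by exists 1, p; split=> [|x _ _]; rewrite hornerE ?oner_eq0 ?divr1. Qed.

Lemma regular_ext c h h' : h =1 h' -> regular_at c h' -> regular_at c h.
Proof.
by move=> e; apply: (@regular_near 1) => [|x _ _]; rewrite ?hornerE ?oner_eq0.
Qed.

Lemma regular_const c a : regular_at c (fun=> a).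
Proof. by apply: regular_ext (regular_poly c a%:P) => x; rewrite hornerE. Qed.

Lemma regularD c h h' :
  regular_at c h -> regular_at c h' -> regular_at c (fun x => h x + h' x).
Proof.
move=> [N [G [Nc hE]]] [N' [G' [N'c h'E]]].
exists (N * N'), (G * N' + G' * N).
split=> [|x xc]; rewrite !hornerE; first by rewrite mulf_neq0.
rewrite mulf_eq0 => /norP[Nx N'x].
by rewrite hE // h'E // addf_div.
Qed.

Lemma regularM c h h' :
  regular_at c h -> regular_at c h' -> regular_at c (fun x => h x * h' x).
Proof.
move=> [N [G [Nc hE]]] [N' [G' [N'c h'E]]].
exists (N * N'), (G * G').
split=> [|x xc]; rewrite !hornerE; first by rewrite mulf_neq0.
rewrite mulf_eq0 => /norP[Nx N'x].
by rewrite hE // h'E // mulf_div.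
Qed.

Lemma regularX c h n : regular_at c h -> regular_at c (fun x => h x ^+ n).
Proof.
move=> hr; elim: n => [|n IHn].
  by apply: regular_ext (regular_const c 1) => x; rewrite expr0.
by apply: regular_ext (regularM hr IHn) => x; rewrite exprS.
Qed.

Lemma regularN c h : regular_at c h -> regular_at c (fun x => - h x).
Proof.
by move/(regularM (regular_const c (-1))); apply: regular_ext=> x; rewrite mulN1r.
Qed.

Lemma regularV c p : p.[c] != 0 -> regular_at c (fun x => (p.[x])^-1).
Proof. by exists p, 1; split=> // x _ px; rewrite hornerE div1r. Qed.

(** Divisibility by a power of 'X - c is read on the Taylor coefficients at c. *)
Lemma dvdp_XsubC_exp p c m :
  (forall i, (i < m)%N -> (p \Po ('X + c%:P))`_i = 0) -> ('X - c%:P) ^+ m %| p.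
Proof.
move=> p0; rewrite -[p](comp_polyXaddC_K _ c) -[p \Po _](poly_take_drop m).
have -> : take_poly m (p \Po ('X + c%:P)) = 0.
  by apply/polyP => i; rewrite coef_take_poly coef0; case: ltnP => // /p0.
by rewrite add0r comp_polyM rmorphXn /= comp_polyX dvdp_mull.
Qed.

(** F, a polynomial in z (outer variable) and x, has order at least r at x = c
    on every curve z = s + w / (x - c), that is, in the coordinates x and
    z - w / (x - c). *)
Definition pole_free r (F : {poly {poly k}}) c w := forall s,
  regular_at c (fun x => F.[(s + w / (x - c))%:P].[x] / (x - c) ^+ r).

(** The coefficient of (x - c)^n in (x - c)^K P(x, u / (x - c)), as a polynomial
    in u. Here K bounds the degree of P in z, so that P(x, u / (x - c)) has a
    pole of order at most K at x = c. *)
Definition blowup_coef (P : {poly {poly k}}) K c n : {poly k} :=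
  \poly_(j < K.+1)
    (if (K <= n + j)%N then (P`_j \Po ('X + c%:P))`_(n + j - K) else 0).

Hypothesis char0 : [pchar k] =i pred0.

(** In characteristic 0 the natural numbers provide infinitely many roots. *)
Lemma poly_fun0 p : (forall x, p.[x] = 0) -> p = 0.
Proof.
move=> p0; pose s := [seq i%:R : k | i <- iota 0 (size p)].
apply: (@roots_geq_poly_eq0 _ _ s); last by rewrite size_map size_iota.
- by apply/allP=> x _; rewrite /root p0 eqxx.
rewrite map_inj_uniq ?iota_uniq // => i j.
wlog le_ij: i j / (i <= j)%N => [hw|/esym/eqP].
  by case/orP: (leq_total i j) => le e; [|symmetry]; apply: hw.
rewrite -subr_eq0 -natrB // (pcharf0P k).1 // subn_eq0 => le_ji.
by apply/eqP; rewrite eqn_leq le_ij.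
Qed.

Lemma coef_comp_scaleX p a i : (p \Po (a *: 'X))`_i = p`_i * a ^+ i.
Proof.
rewrite coef_comp_poly; case: (ltnP i (size p)) => hi.
  rewrite (bigD1 (Ordinal hi)) //= big1 ?addr0 => [|j /negPf ji].
    by rewrite exprZn coefZ coefXn eqxx mulr1.
  rewrite exprZn coefZ coefXn; case: eqP => [e|]; last by rewrite !mulr0.
  by rewrite -val_eqE /= e eqxx in ji.
rewrite nth_default // mul0r big1 // => j _.
by rewrite exprZn coefZ coefXn gtn_eqF ?mulr0 // (leq_trans _ hi).
Qed.

(** Multiplying by (x - c)^K clears all denominators, and the poles that remain
    in the function lie away from c, hence are coprime to x - c. *)
Lemma regular_blowup_dvd (P : {poly {poly k}}) K r c b s :
  (size P <= K.+1)%N ->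
  regular_at c (fun x => P.[(s + b / (x - c))%:P].[x] / (x - c) ^+ r) ->
  'X^(K + r) %| \sum_(j < K.+1)
     (P`_j \Po ('X + c%:P)) * 'X^(K - j) * (s *: 'X + b%:P) ^+ j.
Proof.
move=> sP [N [G [Nc hE]]]; set S := \sum_(j < _) _.
pose tr p := p \Po ('X + c%:P).
have trE p x : (tr p).[x] = p.[x + c] by rewrite horner_comp !hornerE.
suff: tr N * S = 'X^(K + r) * tr G.
  move=> e; rewrite -(@Gauss_dvdpr _ S (tr N)) ?e ?dvdp_mulr //.
  rewrite coprimep_expl // coprimep_sym -['X]subr0.
  by rewrite coprimep_XsubC /root trE add0r.
have trN0 : tr N != 0.
  by apply: contraNneq Nc => e; rewrite -(add0r c) -trE e horner0.
apply/eqP; rewrite -subr_eq0.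
have ne0 : 'X * tr N != 0 by rewrite mulf_neq0 ?polyX_eq0.
rewrite -(mulrI_eq0 _ (mulfI ne0)); apply/eqP/poly_fun0 => x.
rewrite !hornerM hornerX hornerD hornerN !hornerM hornerXn !trE.
have [->|x0] := eqVneq x 0; first by rewrite !mul0r.
have [->|Nx] := eqVneq N.[x + c] 0; first by rewrite mulr0 !mul0r.
have xc : x + c != c by rewrite -subr_eq0 addrK.
have /= := hE _ xc Nx; rewrite addrK => h.
have -> : G.[x + c] = N.[x + c] * (P.[(s + b / x)%:P].[x + c] / x ^+ r).
  by rewrite h mulrCA mulfV // mulr1.
have -> : P.[(s + b / x)%:P].[x + c] = S.[x] / x ^+ K.
  rewrite /S (horner_coef_wide _ sP) !horner_sum mulr_suml; apply: eq_bigr => j _.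
  rewrite !hornerM -polyC_exp hornerC !horner_exp trE !hornerE.
  have jK : (j <= K)%N by rewrite -ltnS.
  have -> : x ^+ K = x ^+ (K - j) * x ^+ j by rewrite -exprD subnK.
  have -> : s + b / x = (s * x + b) / x by rewrite mulrDl mulfK.
  rewrite expr_div_n.
  have xKj : x ^+ (K - j) != 0 by rewrite expf_neq0.
  have xj : x ^+ j != 0 by rewrite expf_neq0.
  by field; rewrite xKj xj.
have xK : x ^+ K != 0 by rewrite expf_neq0.
have xr : x ^+ r != 0 by rewrite expf_neq0.
by rewrite exprD; field; rewrite xr xK.
Qed.

(** The polynomial (x - c)^K P(x, u / (x - c)) in (x - c, u) vanishes to order
    K + r along every line u = b + s (x - c) through the point (0, b). As s takes
    infinitely many values, it has multiplicity at least K + r at that point, so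
    that its coefficient of (x - c)^n is divisible by (u - b)^(K + r - n). *)
Lemma blowup_dvd (P : {poly {poly k}}) K r c b n :
  (size P <= K.+1)%N ->
  pole_free r P c b ->
  ('X - b%:P) ^+ (K + r - n) %| blowup_coef P K c n.
Proof.
move=> sP reg; set g := blowup_coef P K c.
have key m : (m < K + r - n)%N -> (g n \Po ('X + b%:P))`_m = 0.
  (* The coefficient of (x - c)^(n + m) along the line of slope s is a polynomial
     in s, with the desired number as its coefficient of s^m. *)
  move=> lt_m; pose t := (n + m)%N.
  pose Q := \poly_(i < t.+1) (g (t - i)%N \Po ('X + b%:P))`_i.
  suff Q0 : Q = 0.
    have : Q`_m = 0 by rewrite Q0 coef0.
    by rewrite coef_poly ltnS leq_addl /t addnK.
  apply: poly_fun0 => s; rewrite horner_poly.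
  have := regular_blowup_dvd sP (reg s); set S := \sum_(j < _) _.
  move=> /dvdpP[q Sq]; have: S`_t = 0.
    by rewrite Sq coefMXn ifT // /t; lia.
  move=> St; rewrite -[RHS]St coef_sum.
  transitivity (\sum_(i < t.+1) \sum_(j < K.+1)
     (g (t - i)%N)`_j * (('X + b%:P) ^+ j)`_i * s ^+ i).
    apply: eq_bigr => i _; rewrite coef_comp_poly -mulr_suml; congr (_ * _).
    rewrite (big_ord_widen_cond K.+1 xpredT
      (fun j => (g (t - i)%N)`_j * (('X + b%:P) ^+ j)`_i)) ?size_poly //.
    rewrite big_mkcond; apply: eq_bigr => j _; case: ltnP => //= hj.
    by rewrite (nth_default _ hj) mul0r.
  rewrite exchange_big /=; apply: eq_bigr => j _.
  rewrite coefMr; apply: eq_bigr => i _.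
  rewrite coef_poly ltn_ord coefMXn -mulrA; congr (_ * _).
    have := ltn_ord i; have := ltn_ord j; rewrite !ltnS => jK iT.
    have -> : (K <= t - i + j)%N = ~~ (t - i < K - j)%N by lia.
    by rewrite if_neg; case: ifP => // /negbT h; congr (_`_ _); lia.
  have -> : s *: 'X + b%:P = ('X + b%:P) \Po (s *: 'X).
    by rewrite comp_polyD comp_polyX comp_polyC.
  by rewrite -rmorphXn /= coef_comp_scaleX.
exact: dvdp_XsubC_exp key.
Qed.

(** For i < m the coefficient of (x - c)^i in the blow-up is divisible by
    (u - b)^(K + r - i), and by u^(K - i) because P has no pole before the
    substitution. The total exponent 2K + r - 2i exceeds the degree K in u, so
    that this coefficient is zero, and with it the i-th Taylor coefficient of
    the leading coefficient of P. *)
Lemma lead_dvd (P : {poly {poly k}}) K r c b m :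
  b != 0 -> (r <= K)%N -> (m.*2 <= (K + r).+1)%N -> (size P <= K.+1)%N ->
  pole_free r P c b ->
  ('X - c%:P) ^+ m %| P`_K.
Proof.
move=> b0 rK mK sP reg; apply: dvdp_XsubC_exp => i im.
have := blowup_dvd i sP reg; set g := blowup_coef _ _ _ _ => gb.
have gX : 'X^(K - i) %| g.
  rewrite -['X]subr0 -polyC0; apply: dvdp_XsubC_exp => j ji.
  rewrite polyC0 addr0 comp_polyXr coef_poly; case: ifP => // _.
  by rewrite ifF //; lia.
have g0 : g = 0.
  apply/eqP/negPn/negP => g0.
  have: 'X^(K - i) * ('X - b%:P) ^+ (K + r - i) %| g.
    rewrite Gauss_dvdp ?gX // coprimep_expl // coprimep_expr //.
    by rewrite coprimep_XsubC /root hornerX.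
  move=> /(dvdp_leq g0); rewrite size_mul ?expf_neq0 ?polyXsubC_eq0 ?polyX_eq0 //.
  rewrite size_polyXn size_exp_XsubC; have := size_poly _ _ : (size g <= K.+1)%N.
  by rewrite -addnn in mK; move: (size g) => n; clear -mK im rK; lia.
have: g`_K = 0 by rewrite g0 coef0.
by rewrite coef_poly ltnSn leq_addl addnK.
Qed.
End PolesAndMultiplicities.

(** * The planar problem *)

Section Auxiliary.
Variable k : fieldType.
Implicit Types (p : {poly k}) (F : {poly {poly k}}) (a c : k).

Lemma coef0_shift p c : (p \Po ('X + c%:P))`_0 = p.[c].
Proof. by rewrite -horner_coef0 horner_comp !hornerE. Qed.

Lemma coef1_shift p c : (p \Po ('X + c%:P))`_1 = p^`().[c].
Proof.
transitivity ((p \Po ('X + c%:P))^`()`_0); first by rewrite coef_deriv mulr1n.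
by rewrite deriv_comp derivD derivX derivC addr0 mulr1 coef0_shift.
Qed.

Lemma size_total_degree F i :
  (forall i j, (6 < i + j)%N -> F`_i`_j = 0) -> (size (F`_i)%R <= 7 - i)%N.
Proof. by move=> dF; apply/leq_sizeP => j ij; apply: dF; lia. Qed.

Lemma size_outer_degree F :
  (forall i j, (6 < i + j)%N -> F`_i`_j = 0) -> (size F <= 7)%N.
Proof.
move=> dF; apply/leq_sizeP => i i7; apply/polyP => j; rewrite coef0.
by apply: dF; lia.
Qed.

(** Downward induction on the degree bound: it suffices to kill the coefficient
    that would be the leading one. *)
Lemma size_shrink (T : nzRingType) (p : {poly T}) n m :
  (size p <= n)%N ->
  (forall i, (m <= i)%N -> (size p <= i.+1)%N -> p`_i = 0) -> (size p <= m)%N.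
Proof.
elim: n => [|n IHn] sp hp; first exact: leq_trans sp _.
have [nm|mn] := ltnP n m; first exact: leq_trans sp nm.
apply: IHn => //; apply/leq_sizeP => i; rewrite leq_eqVlt => /predU1P[<-|ni].
  exact: hp.
by rewrite nth_default // (leq_trans sp).
Qed.

(** The quotient is a constant, for degree reasons. *)
Lemma XsubC_exp_dvdE p a m : (size p <= m.+1)%N ->
  ('X - a%:P) ^+ m %| p -> p = p`_m *: ('X - a%:P) ^+ m.
Proof.
move=> sp /dvdpP[u pu]; have [u0|u0] := eqVneq u 0.
  by rewrite pu u0 mul0r coef0 scale0r.
have su : (size u <= 1)%N.
  move: sp; rewrite pu size_Mmonic ?monic_exp ?monicXsubC // size_exp_XsubC.
  by lia.
rewrite (size1_polyC su) mul_polyC in pu.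
rewrite pu coefZ; congr (_ *: _).
have /monicP := monic_exp m (monicXsubC a).
by rewrite lead_coefE size_exp_XsubC /= => ->; rewrite mulr1.
Qed.

(** The polynomial is a multiple of ('X - a)^m, whose constant term is not zero. *)
Lemma XsubC_exp_dvd_eq0 p a m : a != 0 -> (size p <= m.+1)%N ->
  ('X - a%:P) ^+ m %| p -> p`_0 = 0 -> p = 0.
Proof.
move=> a0 sp /(XsubC_exp_dvdE sp) e p0; move: (p0); rewrite {1}e coefZ.
rewrite -horner_coef0 horner_exp !hornerE => /eqP; rewrite mulf_eq0.
by rewrite expf_eq0 oppr_eq0 (negPf a0) andbF orbF => /eqP pm; rewrite e pm scale0r.
Qed.

Lemma swap_size F n :
  (forall i j, (n <= j)%N -> F`_i`_j = 0) -> (size (swapXY F) <= n)%N.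
Proof.
move=> F0; apply/leq_sizeP => j nj; apply/polyP => i.
by rewrite coef_swapXY F0 // coef0.
Qed.

Lemma swap_coef_size F n j : (size F <= n)%N -> (size ((swapXY F)`_j)%R <= n)%N.
Proof.
move=> sF; apply/leq_sizeP => i ni.
by rewrite coef_swapXY (nth_default _ (leq_trans sF ni)) coef0.
Qed.

Lemma blowup_coef_swap F K n j :
  (blowup_coef (swapXY F) K 0 n)`_j =
  if (j < K.+1)%N && (K <= n + j)%N then F`_(n + j - K)`_j else 0.
Proof.
rewrite coef_poly polyC0 addr0 comp_polyXr coef_swapXY.
by case: ltnP => //; case: leqP.
Qed.

End Auxiliary.

(** F1, F2, F3 are dx/dt, dy/dt, dz/dt on a plane x - y = d, as polynomials in
    z (outer variable) and x. The lines x = e of the charts that shift z cut the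
    plane at c1, c2 and the lines y = e' at c3, c4; w c is the weight of the
    chart at the pole c, and b the parameter of the chart that translates x
    and y. *)
Section Planar.
Variable k : fieldType.
Hypothesis char0 : [pchar k] =i pred0.
Implicit Types (F : {poly {poly k}}) (c : k).
Variables (c1 c2 c3 c4 b : k) (w : k -> k) (F1 F2 F3 : {poly {poly k}}).
Let cs := [:: c1; c2; c3; c4].
Hypothesis uniq_cs : uniq cs.
Hypothesis b0 : b != 0.
Hypothesis w0 : forall c, w c != 0.
Hypothesis deg1 : forall i j, (6 < i + j)%N -> F1`_i`_j = 0.
Hypothesis deg2 : forall i j, (6 < i + j)%N -> F2`_i`_j = 0.
Hypothesis deg3 : forall i j, (6 < i + j)%N -> F3`_i`_j = 0.
Hypothesis pole1 : forall c, c \in cs -> pole_free 0 F1 c (w c).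
Hypothesis pole2 : forall c, c \in cs -> pole_free 0 F2 c (w c).
(** (x - c)^2 d/dt (z - w / (x - c)), when F is the derivative of x. *)
Let shifted c (F : {poly {poly k}}) := (('X - c%:P) ^+ 2)%:P * F3 + (w c)%:P%:P * F.
Hypothesis pole31 : forall c, c \in [:: c1; c2] -> pole_free 2 (shifted c F1) c (w c).
Hypothesis pole32 : forall c, c \in [:: c3; c4] -> pole_free 2 (shifted c F2) c (w c).
Hypothesis polez12 : pole_free 0 (swapXY (F1 - F2)) 0 (- b).
Hypothesis polez3 : pole_free 0 (swapXY F3) 0 (- b).
(** z^2 d/dt (x + b / z). *)
Let translated := 'X^2 * F1 - b%:P%:P * F3.
Hypothesis polez13 : pole_free 2 (swapXY translated) 0 (- b).

Let q : {poly k} := \prod_(c <- cs) ('X - c%:P).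

Lemma four_roots_eq0 (p : {poly k}) :
  (forall c, c \in cs -> root p c) -> (size p <= 4)%N -> p = 0.
Proof. by move=> rp sp; apply: (roots_geq_poly_eq0 _ uniq_cs) => //; apply/allP. Qed.

(** From degree 3 in z on, the leading coefficient would be a polynomial of degree
    at most 3 that vanishes at the four poles. *)
Lemma zdeg_le2 F :
  (forall i j, (6 < i + j)%N -> F`_i`_j = 0) ->
  (forall c, c \in cs -> pole_free 0 F c (w c)) -> (size F <= 3)%N.
Proof.
move=> dF rF; apply: (size_shrink (size_outer_degree dF)) => i i3 si.
apply: four_roots_eq0 => [c ccs|]; last first.
  by apply: leq_trans (size_total_degree i dF) _; lia.
by rewrite root_factor_theorem -['X - _]expr1
  (lead_dvd char0 _ _ _ si (rF c ccs)) ?w0 //; lia.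
Qed.

Let sF1 : (size F1 <= 3)%N. Proof. exact: zdeg_le2. Qed.
Let sF2 : (size F2 <= 3)%N. Proof. exact: zdeg_le2. Qed.

Lemma shifted_coef c F i :
  (shifted c F)`_i = ('X - c%:P) ^+ 2 * F3`_i + (w c)%:P * F`_i.
Proof. by rewrite coefD !coefCM. Qed.

Lemma shifted_size c F n :
  (size F <= n)%N -> (size F3 <= n)%N -> (size (shifted c F) <= n)%N.
Proof.
move=> /leq_sizeP s1 /leq_sizeP s3; apply/leq_sizeP => i ni.
by rewrite shifted_coef s1 // s3 // !mulr0 addr0.
Qed.

Lemma pole3P c : c \in cs -> exists F, [/\ F = F1 \/ F = F2, (size F <= 3)%N
  & pole_free 2 (shifted c F) c (w c)].
Proof.
rewrite -[cs]/([:: c1; c2] ++ [:: c3; c4]) mem_cat => /orP[h|h].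
- by exists F1; split; [left | | apply: pole31].
- by exists F2; split; [right | | apply: pole32].
Qed.

(** Here the pole of order 2 costs a factor (x - c)^2, but F1 and F2 have degree
    at most 2 in z and do not interfere. *)
Let sF3 : (size F3 <= 3)%N.
Proof.
apply: (size_shrink (size_outer_degree deg3)) => i i3 si.
apply: four_roots_eq0 => [c ccs|]; last first.
  by apply: leq_trans (size_total_degree i deg3) _; lia.
have [F [_ sF rF]] := pole3P ccs.
have sv : (size (shifted c F) <= i.+1)%N by apply: shifted_size => //; lia.
have := lead_dvd char0 (m := 3) (w0 c) _ _ sv rF.
rewrite shifted_coef (nth_default _ (leq_trans sF i3)) mulr0 addr0.
rewrite (exprD _ 2 1) dvdp_mul2l ?expf_neq0 ?polyXsubC_eq0 // expr1.
by rewrite root_factor_theorem; apply; lia.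
Qed.

(** The coefficient of z^2 has degree at most 4 and vanishes at the four poles; the
    condition on dz/dt forces a double zero at the pole c. *)
Lemma zdeg_le1 F c : c \in cs -> (size F <= 3)%N ->
  (forall i j, (6 < i + j)%N -> F`_i`_j = 0) ->
  (forall a, a \in cs -> pole_free 0 F a (w a)) ->
  pole_free 2 (shifted c F) c (w c) -> (size F <= 2)%N.
Proof.
move=> ccs sF dF r0 r2; apply: (size_shrink sF) => i i2 si.
have [->|ne2] := eqVneq i 2; last by rewrite nth_default // (leq_trans sF) //; lia.
have: ('X - c%:P) ^+ 2 %| F`_2.
  have := lead_dvd char0 (m := 2) (w0 c) _ _ (shifted_size c sF sF3) r2.
  rewrite shifted_coef dvdp_addr; last by rewrite dvdp_mulr.
  by rewrite mul_polyC dvdpZr //; apply.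
move=> /dvdpP[p Fp]; suff p0 : p * ('X - c%:P) = 0.
  by rewrite Fp exprS mulrA p0 mul0r.
apply: four_roots_eq0 => [a acs|]; last first.
  have [->|p0] := eqVneq p 0; first by rewrite mul0r size_poly0.
  have := size_total_degree 2 dF.
  rewrite Fp (size_Mmonic p0) ?monic_exp ?monicXsubC // size_exp_XsubC.
  rewrite (size_Mmonic p0) ?monicXsubC // size_XsubC.
  by move: (size p) => n; lia.
have [->|ac] := eqVneq a c; first by rewrite root_factor_theorem dvdp_mull.
have: root F`_2 a.
  by rewrite root_factor_theorem -['X - a%:P]expr1
    (lead_dvd char0 _ _ _ sF (r0 a acs)) ?w0.
by rewrite Fp !rootM !root_XsubC (negPf ac) !orbF.
Qed.

Let sF1' : (size F1 <= 2)%N.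
Proof.
apply: (@zdeg_le1 F1 c1) => //; first exact: mem_head.
by apply: pole31; rewrite mem_head.
Qed.

Let sF2' : (size F2 <= 2)%N.
Proof.
apply: (@zdeg_le1 F2 c3) => //; first by rewrite !inE eqxx !orbT.
by apply: pole32; rewrite mem_head.
Qed.

Lemma zcoef1_root F :
  (size F <= 2)%N ->
  (forall a, a \in cs -> pole_free 0 F a (w a)) ->
  forall c, c \in cs -> root F`_1 c.
Proof.
move=> sF rF c ccs.
by rewrite root_factor_theorem -['X - c%:P]expr1
  (lead_dvd char0 _ _ _ sF (rF c ccs)) ?w0.
Qed.

(** The coefficient of (x - c)^2 in the blow-up has degree at most 2 in u and is
    divisible by (u - w)^2, hence proportional to it; this ties the values at
    the pole of the three components together. *)
Lemma pole_relations c F : (size F <= 2)%N -> pole_free 2 (shifted c F) c (w c) ->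
  (F`_1)^`().[c] = - (2 * (F3`_2).[c]) /\ (F`_0).[c] = w c * (F3`_2).[c].
Proof.
move=> sF /(blowup_dvd char0 2 (shifted_size c (leq_trans sF (leqnSn _)) sF3)).
have sq j : (('X - c%:P) ^+ 2 * F3`_j) \Po ('X + c%:P)
    = (F3`_j \Po ('X + c%:P)) * 'X^2.
  rewrite comp_polyM rmorphXn /= comp_polyB comp_polyX comp_polyC addrK.
  by rewrite mulrC.
set g := blowup_coef _ _ _ _ => /XsubC_exp_dvdE; rewrite size_poly => /(_ isT) ge.
have g2 : g`_2 = (F3`_2).[c].
  rewrite coef_poly /= shifted_coef comp_polyD sq coefD coefMXn /= coef0_shift.
  by rewrite (nth_default _ sF) mulr0 comp_poly0 coef0 addr0.
have g1 : g`_1 = w c * (F`_1)^`().[c].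
  rewrite coef_poly /= shifted_coef comp_polyD sq coefD coefMXn /= add0r.
  by rewrite mul_polyC comp_polyZ coefZ coef1_shift.
have g0 : g`_0 = w c * (F`_0).[c].
  rewrite coef_poly /= shifted_coef comp_polyD sq coefD coefMXn /= add0r.
  by rewrite mul_polyC comp_polyZ coefZ coef0_shift.
have sqE : ('X - (w c)%:P) ^+ 2 = 'X^2 - (2 * w c) *: 'X + (w c ^+ 2)%:P.
  by rewrite -mul_polyC polyCM rmorphXn /=; ring.
rewrite sqE g2 in ge.
split; apply: (mulfI (w0 c)).
- by rewrite -g1 ge !coefE /=; ring.
- by rewrite -g0 ge !coefE /=; ring.
Qed.

(** The exchange of x and z turns the translation chart into a shift of x with
    its pole at z = 0, to which the same bound on leading coefficients applies:
    large degrees in x need large powers of z. *)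
Lemma swap_lead_eq0 F r K m n :
  (r <= K)%N -> (m.*2 <= (K + r).+1)%N -> (n <= m)%N -> (size F <= n)%N ->
  (size (swapXY F) <= K.+1)%N -> pole_free r (swapXY F) 0 (- b) ->
  (swapXY F)`_K = 0.
Proof.
move=> rK mK nm sF sK rF; have nb0 : - b != 0 by rewrite oppr_eq0.
have := lead_dvd char0 nb0 rK mK sK rF.
rewrite polyC0 subr0 => /dvdpP[p e]; have := swap_coef_size K sF.
have [p0|p0] := eqVneq p 0; first by rewrite e p0 mul0r.
rewrite e size_Mmonic ?monicXn // size_polyXn; have := lt0n (size p); rewrite size_poly_eq0 p0.
by move: (size p) => sp; lia.
Qed.

Lemma swap_lead_coef F r K m i :
  (r <= K)%N -> (m.*2 <= (K + r).+1)%N -> (i < m)%N ->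
  (size (swapXY F) <= K.+1)%N -> pole_free r (swapXY F) 0 (- b) ->
  F`_i`_K = 0.
Proof.
move=> rK mK im sK rF; have nb0 : - b != 0 by rewrite oppr_eq0.
have := lead_dvd char0 nb0 rK mK sK rF.
rewrite polyC0 subr0 -coef_swapXY => /dvdpP[p ->].
by rewrite coefMXn im.
Qed.

Lemma q_monic : q \is monic. Proof. exact: monic_prod_XsubC. Qed.

Lemma size_q : size q = 5%N. Proof. by rewrite size_prod_XsubC. Qed.

Lemma dvd_q (p : {poly k}) : (forall c, c \in cs -> root p c) -> q %| p.
Proof.
by move=> rp; apply: uniq_roots_dvdp; rewrite ?uniq_rootsE //; apply/allP.
Qed.

Let diff_size : (size (F1 - F2)%R <= 2)%N.
Proof. by rewrite (leq_trans (size_polyD _ _)) // size_polyN geq_max sF1' sF2'. Qed.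

(** The difference x - y is a coordinate of the translation chart, so F1 - F2 has
    degree at most 2 in x; but its coefficient of z is divisible by the
    quartic q. *)
Lemma diff_zcoef1 : F2`_1 = F1`_1.
Proof.
have s3 : (size (swapXY (F1 - F2)) <= 3)%N.
  apply: (@size_shrink _ _ 7) => [|i i3 si].
    by apply: swap_size => i j j7; rewrite !coefB deg1 ?deg2 ?subrr //; lia.
  by apply: (swap_lead_eq0 (m := 2) _ _ _ diff_size si polez12) => //; lia.
have s13 : (size (F1`_1 - F2`_1)%R <= 3)%N.
  apply/leq_sizeP => j j3; rewrite -coefB -coef_swapXY.
  by rewrite (nth_default _ (leq_trans s3 j3)) coef0.
have := dvd_q (zcoef1_root sF1' pole1); have := dvd_q (zcoef1_root sF2' pole2).
move=> h2 h1; have := dvdp_sub h1 h2.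
apply: contraTeq => ne; apply/negP => /dvdp_leq; rewrite subr_eq0 eq_sym => /(_ ne).
by rewrite size_q leqNgt ltnS ltnW.
Qed.

Lemma diff_const : F1 - F2 = (F1`_0`_0 - F2`_0`_0)%:P%:P.
Proof.
have s1 : (size (F1 - F2)%R <= 1)%N.
  apply/leq_sizeP => -[//|[_|j _]]; first by rewrite coefB diff_zcoef1 subrr.
  by rewrite nth_default // (leq_trans diff_size).
have s2 : (size (swapXY (F1 - F2)) <= 1)%N.
  apply: (@size_shrink _ _ 7) => [|i i1 si].
    by apply: swap_size => i j j7; rewrite !coefB deg1 ?deg2 ?subrr //; lia.
  by apply: (swap_lead_eq0 (m := 1) _ _ _ s1 si polez12) => //; lia.
rewrite {1}[F1 - F2](size1_polyC s1) !coefB; congr (_%:P).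
apply/polyP => j; rewrite coefC coefB; case: j => [//|j] /=.
rewrite -!coefB -coef_swapXY.
by rewrite (nth_default _ (leq_trans s2 _)) ?coef0.
Qed.

Lemma translated_coef i :
  translated`_i = (if (i < 2)%N then 0 else F1`_(i - 2)) - b *: F3`_i.
Proof. by rewrite coefB coefXnM coefCM mul_polyC. Qed.

Let translated_size : (size translated <= 4)%N.
Proof.
apply/leq_sizeP => i i4; rewrite translated_coef ifF ?(nth_default _ (leq_trans sF1' _)) //; try lia.
by rewrite (nth_default _ (leq_trans sF3 _)) ?scaler0 ?subrr //; lia.
Qed.

Let F3_xsize : (size (swapXY F3) <= 5)%N.
Proof.
apply: (@size_shrink _ _ 7) => [|i i3 si].
  by apply: swap_size => i j j7; rewrite deg3 //; lia.
by apply: (swap_lead_eq0 (m := 3) _ _ _ sF3 si polez3) => //; lia.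
Qed.

Let translated_xsize : (size (swapXY translated) <= 5)%N.
Proof.
apply: (@size_shrink _ _ 7) => [|i i3 si].
  apply: swap_size => i j j7; rewrite translated_coef coefB coefZ deg3; last by lia.
  by case: ifP; rewrite ?coef0 ?deg1 ?mulr0 ?subrr //; lia.
by apply: (swap_lead_eq0 (m := 4) _ _ _ translated_size si polez13) => //; lia.
Qed.

Let nb0 : - b != 0. Proof. by rewrite oppr_eq0. Qed.

(** The successive coefficients in z of the blow-up at z = 0. The n-th one is
    divisible by (u + b)^(6 - n), and has degree at most 4 in u = x z. *)
Let g n := blowup_coef (swapXY translated) 4 0 n.

Let g_dvd n : ('X - (- b)%:P) ^+ (6 - n) %| g n.
Proof. exact: (blowup_dvd char0 n translated_xsize polez13). Qed.

Let g_size n : (size (g n) <= 5)%N. Proof. exact: size_poly. Qed.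

Let h0 j : translated`_0`_j = - (b * F3`_0`_j).
Proof. by rewrite translated_coef sub0r coefN coefZ. Qed.
Let h1 j : translated`_1`_j = - (b * F3`_1`_j).
Proof. by rewrite translated_coef sub0r coefN coefZ. Qed.
Let h2 j : translated`_2`_j = F1`_0`_j - b * F3`_2`_j.
Proof. by rewrite translated_coef coefB coefZ. Qed.
Let h3 j : translated`_3`_j = F1`_1`_j.
Proof.
by rewrite translated_coef coefB coefZ (nth_default _ sF3) coef0 mulr0 subr0.
Qed.
Let h4 j : translated`_4`_j = 0.
Proof. by rewrite (nth_default _ translated_size) coef0. Qed.

Let h_high i j : (4 < j)%N -> translated`_i`_j = 0.
Proof.
by move=> j4; rewrite -coef_swapXY (nth_default _ (leq_trans translated_xsize _)) ?coef0.
Qed.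

Let h_top i : (i < 3)%N -> translated`_i`_4 = 0.
Proof.
by move=> i3; apply: (swap_lead_coef (m := 3) _ _ _ translated_xsize polez13).
Qed.

Let cancel_b x : - (b * x) = 0 -> x = 0.
Proof. by move=> /eqP; rewrite oppr_eq0 mulf_eq0 (negPf b0) => /eqP. Qed.

Lemma F3_0_size : (size (F3`_0)%R <= 2)%N.
Proof.
have g1 : g 1 = 0.
  apply: (@XsubC_exp_dvd_eq0 _ _ _ 5 nb0 _ (g_dvd 1)).
    exact: leq_trans (g_size _) _.
  by rewrite blowup_coef_swap.
have g2 : g 2 = 0.
  by apply: (@XsubC_exp_dvd_eq0 _ _ _ 4 nb0 _ (g_dvd 2)) => //; rewrite blowup_coef_swap.
apply/leq_sizeP => -[|[|[|[|[|j]]]]] // _; apply: cancel_b; rewrite -h0.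
- by have := blowup_coef_swap translated 4 2 2; rewrite -/(g _) g2 coef0 /= => <-.
- by have := blowup_coef_swap translated 4 1 3; rewrite -/(g _) g1 coef0 /= => <-.
- exact: h_top.
- exact: h_high.
Qed.

Lemma F3_1_size : (size (F3`_1)%R <= 3)%N.
Proof.
have g2 : g 2 = 0.
  by apply: (@XsubC_exp_dvd_eq0 _ _ _ 4 nb0 _ (g_dvd 2)) => //; rewrite blowup_coef_swap.
apply/leq_sizeP => -[|[|[|[|[|j]]]]] // _; apply: cancel_b; rewrite -h1.
- by have := blowup_coef_swap translated 4 2 3; rewrite -/(g _) g2 coef0 /= => <-.
- exact: h_top.
- exact: h_high.
Qed.

Lemma F3_2_size : (size (F3`_2)%R <= 4)%N.
Proof.
have h4' : F3`_2`_4 = 0.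
  (* What precedes reduces this coefficient of the blow-up to its top monomial,
     of which -b cannot be a root. *)
  have := blowup_dvd char0 2 F3_xsize polez3; set e := blowup_coef _ _ _ _.
  have eE : e = F3`_2`_4 *: 'X^4.
    apply/polyP => j; rewrite blowup_coef_swap coefZ coefXn.
    case: j => [|[|[|[|[|j]]]]] /=; rewrite ?mulr0 ?mulr1 //.
    - by rewrite (nth_default _ F3_0_size).
    - by rewrite (nth_default _ F3_1_size).
  rewrite eE /= => /(dvdp_trans (dvdp_exp2l _ (isT : (1 <= 2)%N))).
  rewrite expr1 -root_factor_theorem rootE hornerZ hornerXn.
  by rewrite mulf_eq0 expf_eq0 /= oppr_eq0 (negPf b0) orbF => /eqP.
apply/leq_sizeP => -[|[|[|[|[|j]]]]] // _.
by rewrite -coef_swapXY (nth_default _ (leq_trans F3_xsize _)) ?coef0.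
Qed.

Lemma F1_0_size : (size (F1`_0)%R <= 4)%N.
Proof.
apply/leq_sizeP => j j4.
have : translated`_2`_j = 0 by case: (ltngtP j 4) j4 => // [/h_high //|-> _]; apply: h_top.
by rewrite h2 (nth_default _ (leq_trans F3_2_size j4)) mulr0 subr0.
Qed.

Let l := F1`_1`_4.

Lemma F1_1E : F1`_1 = l *: q.
Proof.
have s5 : (size (F1`_1)%R <= 5)%N.
  by apply/leq_sizeP => j j5; rewrite -h3 h_high.
have /dvdpP[p pE] := dvd_q (zcoef1_root sF1' pole1).
have [p0|p0] := eqVneq p 0; first by rewrite /l pE p0 mul0r coef0 scale0r.
have p1 : (size p <= 1)%N.
  move: s5; rewrite pE (size_Mmonic p0 q_monic) size_q.
  by move: (size p) => n; lia.
rewrite (size1_polyC p1) mul_polyC in pE.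
rewrite /l pE coefZ; congr (_ *: _).
by have /monicP := q_monic; rewrite lead_coefE size_q => ->; rewrite mulr1.
Qed.

Lemma F3_2E : F3`_2 = - (l / 2) *: q^`().
Proof.
have two0 : 2 != 0 :> k by rewrite (pcharf0P k).1.
apply/eqP; rewrite -subr_eq0 scaleNr opprK; apply/eqP.
apply: four_roots_eq0 => [c ccs|].
  rewrite -[cs]/([:: c1; c2] ++ [:: c3; c4]) mem_cat in ccs.
  rewrite rootE hornerD hornerZ.
  suff val : (F3`_2).[c] = - ((F1`_1)^`().[c] / 2).
    by rewrite val F1_1E derivZ hornerZ mulrAC addNr.
  case/orP: ccs => h.
    have [-> _] := pole_relations sF1' (pole31 h).
    by field.
  rewrite -diff_zcoef1; have [-> _] := pole_relations sF2' (pole32 h).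
  by field.
rewrite (leq_trans (size_polyD _ _)) // geq_max F3_2_size.
rewrite (leq_trans (size_scale_leq _ _)) //.
by rewrite -ltnS -size_q lt_size_deriv // -size_poly_gt0 size_q.
Qed.

Lemma F1_0_value c : c \in [:: c1; c2] -> (F1`_0).[c] = w c * (F3`_2).[c].
Proof. by move=> h; have [_ ->] := pole_relations sF1' (pole31 h). Qed.

Lemma F2_0_value c : c \in [:: c3; c4] -> (F2`_0).[c] = w c * (F3`_2).[c].
Proof. by move=> h; have [_ ->] := pole_relations sF2' (pole32 h). Qed.

Let q4 : q`_4 = 1.
Proof. by have /monicP := q_monic; rewrite lead_coefE size_q. Qed.

Let F3_2_coef j : F3`_2`_j = - (l / 2) * (q`_j.+1 *+ j.+1).
Proof. by rewrite F3_2E coefZ coef_deriv. Qed.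

Let F1_1_coef j : F1`_1`_j = l * q`_j.
Proof. by rewrite F1_1E coefZ. Qed.

Let two0 : 2 != 0 :> k. Proof. by rewrite (pcharf0P k).1. Qed.

Let g_coef n j : (g n)`_j =
  if (j < 5)%N && (4 <= n + j)%N then translated`_(n + j - 4)`_j else 0.
Proof. exact: blowup_coef_swap. Qed.

Let gE n : g n = \sum_(j < 5) (g n)`_j *: 'X^j.
Proof.
rewrite -poly_def; apply/polyP => j; rewrite coef_poly.
by case: ltnP => // j5; rewrite nth_default // (leq_trans (g_size n)).
Qed.

(** The constant term is zero, which leaves room for one factor u besides
    (u + b)^3. *)
Lemma blowup3E : g 3 = l *: ('X * ('X + b%:P) ^+ 3).
Proof.
have gX : g 3 = drop_poly 1 (g 3) * 'X.
  rewrite -[LHS](poly_take_drop 1) expr1 -[RHS]add0r; congr (_ + _).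
  by apply/polyP => -[|j]; rewrite coef_take_poly coef0 //= g_coef.
have : ('X - (- b)%:P) ^+ 3 %| drop_poly 1 (g 3).
  have := g_dvd 3; rewrite {1}gX Gauss_dvdpl // coprimep_expl //.
  by rewrite coprimep_sym coprimep_XsubC /root hornerX.
move=> /XsubC_exp_dvdE; rewrite size_drop_poly leq_subLR => /(_ (g_size 3)).
rewrite coef_drop_poly g_coef /= h3 -/l polyCN opprK => e.
by rewrite gX e -scalerAl mulrC.
Qed.

Lemma blowup3_coef :
  [/\ (g 3)`_1 = b ^+ 3 * l, (g 3)`_2 = 3 * b ^+ 2 * l & (g 3)`_3 = 3 * b * l].
Proof.
have -> : g 3 = l *: ('X^4 + (3 * b) *: 'X^3 + (3 * b ^+ 2) *: 'X^2 + (b ^+ 3) *: 'X).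
  by rewrite blowup3E -!mul_polyC; ring.
by split; rewrite !coefE /=; ring.
Qed.

Lemma F1_0_3 : F1`_0`_3 = b * l.
Proof.
have [_ _] := blowup3_coef; rewrite g_coef /= h2 F3_2_coef q4 => e.
have -> : F1`_0`_3 = 3 * b * l + b * (- (l / 2) * 4%:R) by rewrite -e; ring.
by field.
Qed.

Lemma F3_0_1 : F3`_0`_1 = - (b ^+ 2 * l).
Proof.
have [e _ _] := blowup3_coef; move: e; rewrite g_coef /= h0 => e.
by apply: (mulfI b0); rewrite -[LHS]opprK e; ring.
Qed.

Lemma F3_1_2 : F3`_1`_2 = - (3 * b * l).
Proof.
have [_ e _] := blowup3_coef; move: e; rewrite g_coef /= h1 => e.
by apply: (mulfI b0); rewrite -[LHS]opprK e; ring.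
Qed.

(** -b is a double root of the fourth coefficient. *)
Lemma blowup4_relations : let A2 := F1`_0`_2 in
  F3`_1`_1 = - (2 * A2) /\ F3`_0`_0 = b ^+ 2 * l * q`_3 / 2 - b * A2.
Proof.
have d4 := g_dvd 4; have e := gE 4.
rewrite !big_ord_recr big_ord0 /= add0r !g_coef /= in e.
rewrite h0 h1 h2 h3 h4 F3_2_coef F1_1_coef scale0r addr0 in e.
have r0 : (g 4).[- b] = 0.
  apply/rootP; rewrite root_factor_theorem.
  by apply: dvdp_trans d4; rewrite dvdp_mulr.
have r1 : (g 4)^`().[- b] = 0.
  case/dvdpP: d4 => p ->; rewrite -[(6 - 4)%N]/2%N expr2 !derivM.
  by rewrite !(hornerM, hornerD, hornerN, hornerX, hornerC); ring.
move: r0 r1; rewrite e !(derivD, derivZ, derivXn).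
rewrite !(hornerD, hornerZ, hornerXn, hornerMn).
set A2 := F1`_0`_2; set B11 := F3`_1`_1; set B00 := F3`_0`_0 => r0 r1 /=.
have B11E : B11 = - (2 * A2).
  apply: (mulfI b0); have /eqP := r1.
  set t := (X in X == 0) => /eqP t0; have -> : b * B11 = b * - (2 * A2) - t.
    by rewrite /t /=; field.
  by rewrite t0 subr0.
split=> //; apply: (mulfI b0); have /eqP := r0.
set t := (X in X == 0) => /eqP t0.
have -> : b * B00 = b * (b ^+ 2 * l * q`_3 / 2 - b * A2) - t.
  by rewrite /t B11E /=; field.
by rewrite t0 subr0.
Qed.

(** -b is a root of the fifth coefficient. *)
Lemma blowup5_relation : F3`_1`_0 = - F1`_0`_1.
Proof.
have h5 j : translated`_5`_j = 0.
  by rewrite (nth_default _ (leq_trans translated_size _)) ?coef0.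
have e := gE 5.
rewrite !big_ord_recr big_ord0 /= add0r !g_coef /= in e.
rewrite h1 h2 h3 h4 h5 F3_2_coef F1_1_coef !scale0r !addr0 in e.
have : (g 5).[- b] = 0.
  apply/rootP; rewrite root_factor_theorem.
  by have := g_dvd 5; rewrite -[(6 - 5)%N]/1%N expr1.
rewrite e !(hornerD, hornerZ, hornerXn).
set t := (X in X = 0) => t0; apply: (mulfI b0).
have -> : b * F3`_1`_0 = b * - F1`_0`_1 - t by rewrite /t /=; field.
by rewrite t0 subr0.
Qed.

Lemma F3_1E : F3`_1 = - (F1`_0)^`().
Proof.
apply/polyP => j; rewrite coefN coef_deriv; case: j => [|[|[|j]]].
- by rewrite blowup5_relation mulr1n.
- by have [-> _] := blowup4_relations; rewrite mulr_natl.
- by rewrite F3_1_2 F1_0_3; ring.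
- rewrite (nth_default _ (leq_trans F3_1_size _)) //.
  by rewrite (nth_default _ (leq_trans F1_0_size _)) // mul0rn oppr0.
Qed.

Lemma F3_0E :
  F3`_0 = - (b ^+ 2 * l) *: 'X + (b ^+ 2 * l * q`_3 / 2 - b * F1`_0`_2)%:P.
Proof.
apply/polyP => j; rewrite coefD coefZ coefX coefC; case: j => [|[|j]] /=.
- by have [_ ->] := blowup4_relations; rewrite mulr0 add0r.
- by rewrite F3_0_1 mulr1 addr0.
- by rewrite (nth_default _ (leq_trans F3_0_size _)) // mulr0 addr0.
Qed.

(** Up to the scalar l, the cubic A and the constant D the system is determined on
    the plane, and the four values of A leave one relation between l and D. *)
Theorem planar_normal_form :
  let A := F1`_0 in let D := F1`_0`_0 - F2`_0`_0 in
  [/\ F1 = A%:P + (l *: q)%:P * 'X, F2 = F1 - D%:P%:P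
    & F3 = (- (b ^+ 2 * l) *: 'X + (b ^+ 2 * l * q`_3 / 2 - b * A`_2)%:P)%:P
       - (A^`())%:P * 'X - ((l / 2) *: q^`())%:P * 'X^2] /\
  [/\ (size A <= 4)%N, A`_3 = b * l,
      forall c, c \in [:: c1; c2] -> A.[c] = - (w c * (l / 2) * q^`().[c])
    & forall c, c \in [:: c3; c4] -> A.[c] = D - w c * (l / 2) * q^`().[c]].
Proof.
move=> A D; split; split.
- apply/polyP => i; rewrite coefD coefC coefMX coefC.
  case: i => [|[|i]] /=; rewrite ?addr0 ?add0r //; first exact: F1_1E.
  by rewrite (nth_default _ (leq_trans sF1' _)).
- by rewrite -diff_const opprB addrC subrK.
- apply/polyP => i; rewrite !coefB coefC coefMX !coefC coefMXn coefC.
  case: i => [|[|[|i]]] /=; rewrite ?coef0 ?subr0 ?sub0r.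
  + by rewrite F3_0E.
  + by rewrite F3_1E.
  + by rewrite F3_2E scaleNr.
  + by rewrite (nth_default _ (leq_trans sF3 _)).
- exact: F1_0_size.
- exact: F1_0_3.
- by move=> c /F1_0_value ->; rewrite F3_2E hornerZ; ring.
- move=> c /F2_0_value; rewrite F3_2E hornerZ => e.
  have -> : A.[c] = (F2`_0).[c] + (F1`_0 - F2`_0).[c] by rewrite hornerD hornerN addrC subrK.
  have -> : F1`_0 - F2`_0 = D%:P by rewrite -coefB diff_const coefC.
  by rewrite e hornerC; ring.
Qed.

End Planar.

(** * Interpolation at the four poles *)

(** The poles 0 and e are the zeros of x and x - e on the plane, and d and d + 1
    those of y and y - 1. *)
Section Interpolation.
Variables (k : fieldType) (e d b0 b1 b2 l D : k) (A : {poly k}).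
Hypothesis two0 : 2 != 0 :> k.
Hypothesis sum_b : b0 + b1 + b2 = 2^-1.
Hypotheses (e0 : e != 0) (d0 : d != 0) (d1 : d + 1 != 0) (de : d - e != 0)
  (d1e : d + 1 - e != 0).
Let q : {poly k} := \prod_(c <- [:: 0; e; d; d + 1]) ('X - c%:P).
Hypothesis sA : (size A <= 4)%N.
Hypothesis A3 : A`_3 = b1 * l.
Hypothesis A_0 : A.[0] = - (b2 * (l / 2) * q^`().[0]).
Hypothesis A_e : A.[e] = - (b0 * (l / 2) * q^`().[e]).
Hypothesis A_d : A.[d] = D - b2 * (l / 2) * q^`().[d].
Hypothesis A_d1 : A.[d + 1] = D - b0 * (l / 2) * q^`().[d + 1].

Lemma cubicE x : A.[x] = A`_0 + A`_1 * x + A`_2 * x ^+ 2 + b1 * l * x ^+ 3.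
Proof.
rewrite (horner_coef_wide _ sA) !big_ord_recr big_ord0 /= add0r A3.
by rewrite expr0 expr1 mulr1.
Qed.

Lemma qE : q = 'X^4 - (2 * d + 1 + e)%:P * 'X^3
  + (d * (d + 1) + e * (2 * d + 1))%:P * 'X^2 - (e * d * (d + 1))%:P * 'X.
Proof. by rewrite /q !big_cons big_nil; ring. Qed.

Lemma q_value x : q.[x] = x * (x - e) * (x - d) * (x - (d + 1)).
Proof. by rewrite /q !big_cons big_nil !hornerM !hornerXsubC hornerC; ring. Qed.

Lemma qd_value x : q^`().[x] =
  4 * x ^+ 3 - 3 * (2 * d + 1 + e) * x ^+ 2
  + 2 * (d * (d + 1) + e * (2 * d + 1)) * x - e * d * (d + 1).
Proof.
rewrite qE !(derivB, derivD, derivM, derivXn, derivX, derivC, mul0r, add0r).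
rewrite !(hornerD, hornerN, hornerM, hornerMn, hornerX, hornerC) /=. ring.
Qed.

Lemma q3E : q`_3 = - (2 * d + 1 + e).
Proof. by rewrite qE !coefE /=; ring. Qed.

(** The third divided difference of the cubic A at the four poles is its leading
    coefficient b1 l. Each pole contributes its weight times -l/2, and the jump D
    between the poles of x and those of y enters through 1/q'(d) + 1/q'(d + 1);
    the sum b0 + b1 + b2 = 1/2 collects all the weights. *)
Lemma jump_relation :
  D * (2 * d + 1 - e) = - (l / 2) * (d * (d - e) * (d + 1) * (d + 1 - e)).
Proof.
have dd : b1 * l = - A.[0] / (e * d * (d + 1))
    + A.[e] / (e * (e - d) * (e - (d + 1)))
    - A.[d] / (d * (d - e)) + A.[d + 1] / ((d + 1) * (d + 1 - e)).
  rewrite !cubicE; field.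
  by rewrite d0 d1 e0 -(opprB d) oppr_eq0 de -(opprB (d + 1)) oppr_eq0 d1e.
rewrite A_0 A_e A_d A_d1 !qd_value in dd.
pose K := d * (d - e) * (d + 1) * (d + 1 - e).
have: K * (b1 * l) = - (D * (2 * d + 1 - e)) - (b0 + b2) * l * K.
  rewrite dd /K; field.
  by rewrite d0 d1 e0 -(opprB d) oppr_eq0 de -(opprB (d + 1)) oppr_eq0 d1e two0.
rewrite -/K => eK.
have -> : D * (2 * d + 1 - e) = - ((b0 + b1 + b2) * l * K) - 
   (- (D * (2 * d + 1 - e)) - (b0 + b2) * l * K - K * (b1 * l)) by ring.
by rewrite -eK subrr subr0 sum_b; field.
Qed.

Variable c : k.
Hypothesis d2 : 2 * d + 1 - e != 0.
Hypothesis lE : l = c * (2 * d + 1 - e).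

Let b0E : b0 = 2^-1 - b1 - b2.
Proof. by rewrite -sum_b; ring. Qed.

Let four0 : 4 != 0 :> k.
Proof.
have -> : 4 = 2 * 2 :> k by ring.
exact: mulf_neq0.
Qed.

Lemma jumpE : D = - (c / 2) * (d * (d - e) * (d + 1) * (d + 1 - e)).
Proof. by apply: (mulIf d2); rewrite jump_relation lE; field. Qed.

Lemma A0E : A`_0 = c * b2 * (2 * d + 1 - e) / 2 * (e * d * (d + 1)).
Proof.
have := A_0; rewrite qd_value cubicE => h.
have -> : A`_0 = A`_0 + A`_1 * 0 + A`_2 * 0 ^+ 2 + b1 * l * 0 ^+ 3 by ring.
by rewrite h lE; field.
Qed.

(** A`_1 and A`_2 solve the linear system given by the values at e and d, of
    determinant e d (d - e). *)
Lemma A2E : A`_2 = c / 4 * (- 1 + 2 * b2 - 2 * b1 + e ^+ 2 - 2 * e ^+ 2 * b2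
  + 2 * e ^+ 2 * b1 - d + 4 * d * b2 - 10 * d * b1 - d * e + 4 * d * e * b2
  + 2 * d * e * b1 - 12 * d ^+ 2 * b1).
Proof.
have det0 : e * d * (d - e) != 0 by rewrite !mulf_neq0.
apply: (mulfI det0).
have -> : e * d * (d - e) * A`_2 =
    e * (A.[d] - A`_0 - b1 * l * d ^+ 3) - d * (A.[e] - A`_0 - b1 * l * e ^+ 3).
  by rewrite !cubicE; ring.
by rewrite A_d A_e A0E jumpE lE !qd_value b0E; field; rewrite four0 two0.
Qed.

Lemma A1E : A`_1 = c / 4 * (2 * e - 4 * e * b2 - 2 * e ^+ 2 + 4 * e ^+ 2 * b2
  - d + 2 * d * b1 + 6 * d * e - 12 * d * e * b2 - 3 * d * e ^+ 2
  + 4 * d * e ^+ 2 * b2 - 2 * d * e ^+ 2 * b1 - 3 * d ^+ 2 + 6 * d ^+ 2 * b1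
  + 5 * d ^+ 2 * e - 8 * d ^+ 2 * e * b2 + 2 * d ^+ 2 * e * b1 - 2 * d ^+ 3
  + 4 * d ^+ 3 * b1).
Proof.
apply: (mulfI e0).
have -> : e * A`_1 = A.[e] - A`_0 - A`_2 * e ^+ 2 - b1 * l * e ^+ 3.
  by rewrite cubicE; ring.
by rewrite A_e A2E A0E lE !qd_value b0E; field; rewrite four0 two0.
Qed.

Lemma first_component x z :
  A.[x] + l * q.[x] * z = - (c / 2) * D4_P e b0 b2 b1 b0 b2 x (x - d) z.
Proof. by rewrite cubicE A0E A1E A2E q_value lE b0E /D4_P; field; rewrite four0 two0. Qed.

Lemma second_component x z :
  A.[x] - D + l * q.[x] * z = c / 2 * D4_Q e b0 b2 b1 b0 b2 x (x - d) z.
Proof. by rewrite jumpE cubicE A0E A1E A2E q_value lE b0E /D4_Q; field; rewrite four0 two0. Qed.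

Lemma third_component x z :
  - (b1 ^+ 2 * l) * x + (b1 ^+ 2 * l * q`_3 / 2 - b1 * A`_2)
    - A^`().[x] * z - l / 2 * q^`().[x] * z ^+ 2
  = - (c / 2) * D4_R e b0 b2 b1 b0 b2 x (x - d) z.
Proof.
have -> : A^`().[x] = A`_1 + 2 * A`_2 * x + 3 * (b1 * l) * x ^+ 2.
  have sdA : (size A^`() <= 3)%N.
    by apply/leq_sizeP => j j3; rewrite coef_deriv nth_default ?mul0rn // (leq_trans sA).
  rewrite (horner_coef_wide _ sdA) !big_ord_recr big_ord0 /= !coef_deriv A3.
  by ring.
by rewrite A1E A2E q3E qd_value lE b0E /D4_R; field; rewrite four0 two0.
Qed.
End Interpolation.

(** * Derivations and values of fractions *)

Section FracDerivation.
Variables (A : idomainType) (D : A -> A).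
Hypothesis DD : forall a b, D (a + b) = D a + D b.
Hypothesis DM : forall a b, D (a * b) = D a * b + a * D b.
Implicit Types (u v : {fraction A}).

Lemma frac_ofP u : exists n d : A, d != 0 /\ u = n%:F / d%:F.
Proof.
exists (frac (repr u)).1, (frac (repr u)).2; split; last exact: frac_reprE.
exact: denom_ratioP.
Qed.

Let tofrac_neq0 (d : A) : d != 0 -> d%:F != 0. Proof. by rewrite tofrac_eq0. Qed.

Lemma frac_der_tofrac a : frac_der D a%:F = (D a)%:F.
Proof.
have D1 : D 1 = 0.
  by have /eqP := DM 1 1; rewrite !mulr1 mul1r -subr_eq0 opprD addNKr oppr_eq0 => /eqP.
rewrite -[a%:F]divr1 -tofrac1 (frac_derE DM) ?oner_neq0 //.
by rewrite D1 mulr0 subr0 mulr1 expr1n tofrac1 divr1.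
Qed.

Lemma frac_derD u v : frac_der D (u + v) = frac_der D u + frac_der D v.
Proof.
have [n [d [d0 ->]]] := frac_ofP u; have [n' [d' [d'0 ->]]] := frac_ofP v.
have F0 := tofrac_neq0 d0; have F'0 := tofrac_neq0 d'0.
rewrite addf_div // -!tofracM -tofracD !(frac_derE DM) ?mulf_neq0 //.
rewrite addf_div -?tofracM -?tofracD ?tofrac_eq0 ?expf_neq0 ?mulf_neq0 //.
apply/eqP; rewrite eqr_div ?tofrac_eq0 ?expf_neq0 ?mulf_neq0 //.
rewrite -!tofracM tofrac_eq; apply/eqP.
by rewrite !(DD, DM); ring.
Qed.

Lemma frac_derM u v : frac_der D (u * v) = frac_der D u * v + u * frac_der D v.
Proof.
have [n [d [d0 ->]]] := frac_ofP u; have [n' [d' [d'0 ->]]] := frac_ofP v.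
have F0 := tofrac_neq0 d0; have F'0 := tofrac_neq0 d'0.
rewrite mulf_div -!tofracM !(frac_derE DM) ?mulf_neq0 // !mulf_div -!tofracM.
rewrite addf_div -?tofracM -?tofracD ?tofrac_eq0 ?expf_neq0 ?mulf_neq0 //.
apply/eqP; rewrite eqr_div ?tofrac_eq0 ?expf_neq0 ?mulf_neq0 //.
rewrite -!tofracM tofrac_eq; apply/eqP.
by rewrite !(DD, DM); ring.
Qed.

End FracDerivation.

Section TotalDerivative.
Variables (n : nat) (F : fieldType) (delta : F -> F).
Hypothesis deltaD : forall a b, delta (a + b) = delta a + delta b.
Hypothesis deltaM : forall a b, delta (a * b) = delta a * b + a * delta b.
Implicit Types (f : 'I_n -> {mpoly F[n]}) (p : {mpoly F[n]}) (c : F).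

(** The derivative along f when delta acts on the coefficients. *)
Definition total_der f p := map_mpoly delta p + \sum_(i < n) f i * p^`M(i).

Let delta0 : delta 0 = 0.
Proof. by apply: (addrI (delta 0)); rewrite -deltaD !addr0. Qed.

Let delta_zmod : zmod_morphism delta.
Proof.
move=> a b; rewrite deltaD; congr (_ + _).
by apply: (addrI (delta b)); rewrite -deltaD !subrr delta0.
Qed.

Let delta_add : {additive F -> F} :=
  HB.pack delta (GRing.isZmodMorphism.Build F F delta delta_zmod).

Let mcoeff_delta m p : (map_mpoly delta p)@_m = delta p@_m.
Proof. exact: (mcoeff_map_mpoly delta_add). Qed.

Let delta_sum (I : Type) (r : seq I) (P : pred I) (E : I -> F) :
  delta (\sum_(i <- r | P i) E i) = \sum_(i <- r | P i) delta (E i).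
Proof. exact: (raddf_sum delta_add). Qed.

Lemma map_deltaM p p' : map_mpoly delta (p * p') =
  map_mpoly delta p * p' + p * map_mpoly delta p'.
Proof.
apply/mpolyP => m; rewrite mcoeffD !mcoeffM mcoeff_delta mcoeffM.
rewrite delta_sum -big_split /=; apply: eq_bigr => i _.
by rewrite !mcoeff_delta; exact: deltaM.
Qed.

Lemma total_derD f p p' : total_der f (p + p') = total_der f p + total_der f p'.
Proof.
rewrite /total_der.
have -> : map_mpoly delta (p + p') = map_mpoly delta p + map_mpoly delta p'.
  exact: (raddfD (map_mpoly delta_add)).
rewrite addrACA -big_split /=.
by congr (_ + _); apply: eq_bigr => i _; rewrite mderivD mulrDr.
Qed.

Lemma total_derM f p p' :
  total_der f (p * p') = total_der f p * p' + p * total_der f p'.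
Proof.
have sM : \sum_(i < n) f i * (p * p')^`M(i) =
    (\sum_(i < n) f i * p^`M(i)) * p' + p * \sum_(i < n) f i * p'^`M(i).
  rewrite big_distrl big_distrr -big_split; apply: eq_bigr => i _ /=.
  by rewrite mderivM mulrDr; congr (_ + _); [apply: mulrA | apply: mulrCA].
by rewrite /total_der map_deltaM sM mulrDl mulrDr addrACA.
Qed.

Lemma total_der_const f c : delta c = 0 -> total_der f c%:MP = 0.
Proof.
move=> c0; rewrite /total_der.
have -> : map_mpoly delta c%:MP = (delta c)%:MP := map_mpolyC n delta_add c.
rewrite c0 mpolyC0 add0r big1 // => i _.
by rewrite mderivC mulr0.
Qed.

Lemma total_der_var f i : total_der f 'X_i = f i.
Proof.
rewrite /total_der.
have -> : map_mpoly delta 'X_i = 0.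
  apply/mpolyP => m; rewrite mcoeff_delta mcoeffX mcoeff0.
  case: eqP => _; last exact: delta0.
  by have /eqP := deltaM 1 1; rewrite !mulr1 mul1r -subr_eq0 opprD addNKr oppr_eq0 => /eqP.
rewrite add0r (bigD1 i) //= big1 ?addr0 => [|j ji].
  rewrite mderivX mnm1E eqxx scale1r.
  have -> : (U_(i) - U_(i))%MM = 0%MM :> 'X_{1..n}.
    by apply/mnmP => j; rewrite mnmBE mnm0E subnn.
  by rewrite mpolyX0 mulr1.
by rewrite mderivX mnm1E eq_sym (negPf ji) scale0r mulr0.
Qed.

End TotalDerivative.

Section Mmap.
Variables (n : nat) (F : nzRingType).

Lemma eq_mmap (S : nzRingType) (f f' : F -> S) (h h' : 'I_n -> S)
    (p : {mpoly F[n]}) : f =1 f' -> h =1 h' -> mmap f h p = mmap f' h' p.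
Proof.
move=> ff' hh'; rewrite /mmap; apply: eq_bigr => m _; rewrite ff'; congr (_ * _).
exact: mmap1_eq.
Qed.

Lemma rmorph_mmap (S S' : comNzRingType) (phi : {rmorphism S -> S'}) (f : F -> S)
    (h : 'I_n -> S) (p : {mpoly F[n]}) :
  phi (mmap f h p) = mmap (phi \o f) (phi \o h) p.
Proof.
rewrite /mmap rmorph_sum; apply: eq_bigr => m _; rewrite rmorphM; congr (_ * _).
by rewrite /mmap1 rmorph_prod; apply: eq_bigr => i _; rewrite rmorphXn.
Qed.
Lemma mmap_id (p : {mpoly F[n]}) : mmap (@mpolyC n F) (fun i => 'X_i) p = p.
Proof.
rewrite [in RHS](mpolyE p) /mmap; apply: eq_bigr => m _.
by rewrite mmap1_id mul_mpolyC.
Qed.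
End Mmap.

Section Values.
Variables (A : nzRingType) (K k : fieldType).
Variables (tau : {rmorphism A -> K}) (ev : {rmorphism A -> k}).
Hypothesis tau_inj : injective tau.
Implicit Types (u : K) (a : k) (p q : A).

(** u lies in the local ring of A at the point ev, and a is its residue there.
    A relation rather than a function, since ev does not extend to all of K. *)
Definition has_value u a := exists p q : A,
  [/\ u = tau p / tau q, ev q != 0 & a = ev p / ev q].

Let tau0 q : ev q != 0 -> tau q != 0.
Proof.
apply: contraNneq => e; have -> : q = 0 by apply: tau_inj; rewrite rmorph0.
by rewrite rmorph0.
Qed.

Lemma has_value_poly p : has_value (tau p) (ev p).
Proof. by exists p, 1; rewrite !rmorph1 !divr1 oner_neq0; split. Qed.

Lemma has_valueD u u' a a' :
  has_value u a -> has_value u' a' -> has_value (u + u') (a + a').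
Proof.
move=> [p [q [-> q0 ->]]] [p' [q' [-> q'0 ->]]].
exists (p * q' + p' * q), (q * q').
have t0 := tau0 q0; have t'0 := tau0 q'0.
by rewrite !rmorphD !rmorphM mulf_neq0 // !addf_div.
Qed.

Lemma has_valueM u u' a a' :
  has_value u a -> has_value u' a' -> has_value (u * u') (a * a').
Proof.
move=> [p [q [-> q0 ->]]] [p' [q' [-> q'0 ->]]].
exists (p * p'), (q * q').
by rewrite !rmorphM mulf_neq0 // !mulf_div; split.
Qed.

Lemma has_value0 : has_value 0 0.
Proof. by have := has_value_poly 0; rewrite !rmorph0. Qed.

Lemma has_value1 : has_value 1 1.
Proof. by have := has_value_poly 1; rewrite !rmorph1. Qed.

Lemma has_valueN u a : has_value u a -> has_value (- u) (- a).
Proof.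
by move=> /(has_valueM (has_value_poly (- 1))); rewrite !rmorphN !rmorph1 !mulN1r.
Qed.

Lemma has_valueV u a : a != 0 -> has_value u a -> has_value u^-1 a^-1.
Proof.
move=> a0 [p [q [-> q0 aE]]]; exists q, p; rewrite aE !invf_div; split=> //.
by apply: contraNneq a0; rewrite aE => ->; rewrite mul0r.
Qed.

Lemma has_valueX u a m : has_value u a -> has_value (u ^+ m) (a ^+ m).
Proof.
move=> ua; elim: m => [|m IHm]; last by rewrite !exprS; apply: has_valueM.
by rewrite !expr0; apply: has_value1.
Qed.

Lemma has_value_uniq u a a' : has_value u a -> has_value u a' -> a = a'.
Proof.
move=> [p [q [-> q0 ->]]] [p' [q' [e q'0 ->]]]; apply/eqP.
rewrite eqr_div // -!rmorphM; move/eqP: e.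
by rewrite eqr_div ?(tau0 q0) ?(tau0 q'0) // -!rmorphM (inj_eq tau_inj) => /eqP->.
Qed.

Lemma has_value_mmap n (F : fieldType) (f : F -> A) (u : 'I_n -> K)
    (w : 'I_n -> k) (p : {mpoly F[n]}) :
  (forall i, has_value (u i) (w i)) ->
  has_value (mmap (tau \o f) u p) (mmap (ev \o f) w p).
Proof.
move=> uw; rewrite /mmap; elim/big_ind2: _ => [|u1 a1 u2 a2|m _].
- exact: has_value0.
- by move=> ? ?; apply: has_valueD.
apply: has_valueM; first exact: has_value_poly.
rewrite /mmap1; elim/big_ind2: _ => [|u1 a1 u2 a2|i _].
- exact: has_value1.
- by move=> ? ?; apply: has_valueM.
- exact: has_valueX.
Qed.
End Values.

Section RegularMmap.
Variables (n : nat) (F k : fieldType) (iota : F -> k).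

Lemma regular_mmap (c : k) (w : 'I_n -> k -> k) (p : {mpoly F[n]}) :
  (forall i, regular_at c (w i)) ->
  regular_at c (fun x => mmap iota (w^~ x) p).
Proof.
move=> rw; rewrite /mmap; elim: (msupp p) => [|m s IHs].
  by apply: regular_ext (regular_const c 0) => x; rewrite big_nil.
apply: (regular_ext _ (regularD _ IHs)) => [x|]; first by rewrite big_cons.
apply: regularM; first exact: regular_const.
rewrite /mmap1; elim: (index_enum _) => [|i r IHr].
  by apply: regular_ext (regular_const c 1) => x; rewrite big_nil.
apply: (regular_ext _ (regularM (regularX (m i) (rw i)) IHr)) => x.
by rewrite big_cons.
Qed.
End RegularMmap.

(** * The charts at points *)

Lemma vec3_ind (P : 'I_3 -> Prop) : P i0 -> P i1 -> P i2 -> forall i, P i.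
Proof.
by move=> p0 p1 p2 [[|[|[|i]]] hi] //; [move: p0|move: p1|move: p2];
  congr P; apply: val_inj.
Qed.

Section Derivation.
Variables (K : fieldType) (D : K -> K).
Hypothesis DD : forall u v, D (u + v) = D u + D v.
Hypothesis DM : forall u v, D (u * v) = D u * v + u * D v.

Lemma derivation0 : D 0 = 0.
Proof. by apply: (addrI (D 0)); rewrite -DD !addr0. Qed.

Lemma derivationN u : D (- u) = - D u.
Proof. by apply: (addrI (D u)); rewrite -DD !subrr derivation0. Qed.

Lemma derivation1 : D 1 = 0.
Proof. by apply: (addrI (D 1)); rewrite addr0 -[in RHS](mulr1 1) DM mulr1 mul1r. Qed.

Lemma derivationV u : u != 0 -> D u^-1 = - (D u / u ^+ 2).
Proof.
move=> u0; have := DM u u^-1; rewrite mulfV // derivation1 => /esym/eqP.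
rewrite addrC addr_eq0 => /eqP e; apply: (mulfI u0); rewrite e mulrN.
by congr (- _); field.
Qed.
End Derivation.

Section Charts.
Variables (F k K : fieldType).
Local Notation A := {mpoly F[3]}.
Variables (tau : {rmorphism A -> K}) (iota : {rmorphism F -> k}) (D : K -> K).
Hypothesis tau_inj : injective tau.
Hypothesis DD : forall u v, D (u + v) = D u + D v.
Hypothesis DM : forall u v, D (u * v) = D u * v + u * D v.
Variable f : 'I_3 -> A.
Hypothesis Dvar : forall i, D (tau 'X_i) = tau (f i).

Local Notation ev v := (mmap iota v).
Local Notation cst e := (tau e%:MP).
Local Notation x := (tau 'X_i0).
Local Notation y := (tau 'X_i1).
Local Notation z := (tau 'X_i2).
Local Notation has_value v := (has_value tau (ev v)).

Definition polynomial_system (u : 'I_3 -> K) :=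
  forall j, exists g : A, D (u j) = mmap (tau \o @mpolyC 3 F) u g.

Lemma has_value_const v e : has_value v (cst e) (iota e).
Proof. by rewrite -(mmapC v iota); apply: has_value_poly. Qed.

Lemma has_value_var v i : has_value v (tau 'X_i) (v i).
Proof. by have := has_value_poly tau (ev v) 'X_i; rewrite /= mmapX mmap1U. Qed.

Lemma has_value_neq0 v u a : has_value v u a -> a != 0 -> u != 0.
Proof.
move=> ua; apply: contraNneq => u0; rewrite u0 in ua.
by rewrite (has_value_uniq tau_inj ua (has_value0 tau (ev v))).
Qed.

(** An identity of fractions specializes to an identity of polynomial functions at
    each point where the coordinates are defined. *)
Lemma chart_value (u : 'I_3 -> K) v w g h a :
  (forall i, has_value v (u i) (w i)) ->
  h = mmap (tau \o @mpolyC 3 F) u g -> has_value v h a -> a = ev w g.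
Proof.
move=> uw -> /(has_value_uniq tau_inj); apply.
rewrite (eq_mmap (f' := ev v \o @mpolyC 3 F) (h' := w) g) //.
  exact: has_value_mmap.
by move=> c /=; rewrite mmapC.
Qed.

Section Shift.
Variables (e e' b : F) (u : 'I_3 -> K).
Hypotheses (De : D (cst e) = 0) (De' : D (cst e') = 0) (Db : D (cst b) = 0).
Hypothesis u0 : u i0 = x - cst e.
Hypothesis u1 : u i1 = y - cst e'.
Hypothesis u2 : u i2 = z - cst b * ((x - cst e)^-1 + (y - cst e')^-1).
Hypothesis poly_u : polynomial_system u.

(** The third component is the derivative of z - b (1/(x - e) + 1/(y - e')). *)
Lemma shift_chart_values : exists g0 g1 g2 : A, forall a0 a1 a2 : k,
  a0 != iota e -> a1 != iota e' ->
  let v := vec3 a0 a1 a2 in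
  let w := vec3 (a0 - iota e) (a1 - iota e')
    (a2 - iota b * ((a0 - iota e)^-1 + (a1 - iota e')^-1)) in
  [/\ ev v (f i0) = ev w g0, ev v (f i1) = ev w g1
    & ev v (f i2) + iota b * (ev v (f i0) / (a0 - iota e) ^+ 2
        + ev v (f i1) / (a1 - iota e') ^+ 2) = ev w g2].
Proof.
have [g0 e0] := poly_u i0; have [g1 e1] := poly_u i1.
have [g2 e2] := poly_u i2; exists g0, g1, g2 => a0 a1 a2 h0 h1 v w.
have vX : has_value v (x - cst e) (a0 - iota e).
  exact: (has_valueD tau_inj (has_value_var v i0) (has_valueN (has_value_const v e))).
have vY : has_value v (y - cst e') (a1 - iota e').
  exact: (has_valueD tau_inj (has_value_var v i1) (has_valueN (has_value_const v e'))).
have X0 : a0 - iota e != 0 by rewrite subr_eq0.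
have Y0 : a1 - iota e' != 0 by rewrite subr_eq0.
have uw i : has_value v (u i) (w i).
  move: i; apply: vec3_ind; rewrite ?u0 ?u1 ?u2 //.
  apply: (has_valueD tau_inj (has_value_var v i2)); apply: has_valueN.
  apply: has_valueM; first exact: has_value_const.
  by apply: (has_valueD tau_inj); apply: has_valueV.
have Du0 : D (u i0) = tau (f i0).
  by rewrite u0 DD (derivationN DD) De oppr0 addr0 Dvar.
have Du1 : D (u i1) = tau (f i1).
  by rewrite u1 DD (derivationN DD) De' oppr0 addr0 Dvar.
have Du2 : D (u i2) = tau (f i2) + cst b * (tau (f i0) / (x - cst e) ^+ 2
    + tau (f i1) / (y - cst e') ^+ 2).
  rewrite u2 DD (derivationN DD) DM Db mul0r add0r DD Dvar.
  rewrite !(derivationV DM) ?(has_value_neq0 vX) ?(has_value_neq0 vY) //.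
  by rewrite -u0 -u1 Du0 Du1 -opprD mulrN opprK.
split.
- by apply: (chart_value uw e0); rewrite Du0; apply: has_value_poly.
- by apply: (chart_value uw e1); rewrite Du1; apply: has_value_poly.
apply: (chart_value uw e2); rewrite Du2.
apply: (has_valueD tau_inj); first exact: has_value_poly.
apply: has_valueM; first exact: has_value_const.
by apply: (has_valueD tau_inj); apply: has_valueM (has_value_poly _ _ _) _;
  apply: has_valueV; rewrite ?expf_neq0 //; apply: has_valueX.
Qed.

End Shift.

Section Translation.
Variables (b : F) (u : 'I_3 -> K).
Hypothesis Db : D (cst b) = 0.
Hypothesis u0 : u i0 = x + cst b / z.
Hypothesis u1 : u i1 = y + cst b / z.
Hypothesis u2 : u i2 = z.
Hypothesis poly_u : polynomial_system u.

Lemma translation_chart_values : exists g0 g1 g2 : A, forall a0 a1 a2 : k,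
  a2 != 0 ->
  let v := vec3 a0 a1 a2 in
  let w := vec3 (a0 + iota b / a2) (a1 + iota b / a2) a2 in
  [/\ ev v (f i0) - iota b * (ev v (f i2) / a2 ^+ 2) = ev w g0,
      ev v (f i1) - iota b * (ev v (f i2) / a2 ^+ 2) = ev w g1
    & ev v (f i2) = ev w g2].
Proof.
have [g0 e0] := poly_u i0; have [g1 e1] := poly_u i1.
have [g2 e2] := poly_u i2; exists g0, g1, g2 => a0 a1 a2 h2 v w.
have vz := has_value_var v i2.
have vbz : has_value v (cst b / z) (iota b / a2).
  apply: has_valueM; first exact: has_value_const.
  exact: has_valueV.
have uw i : has_value v (u i) (w i).
  move: i; apply: vec3_ind; rewrite ?u0 ?u1 ?u2 //.
  - exact: (has_valueD tau_inj (has_value_var v i0)).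
  - exact: (has_valueD tau_inj (has_value_var v i1)).
have Dbz : D (cst b / z) = - (cst b * (tau (f i2) / z ^+ 2)).
  by rewrite DM Db mul0r add0r (derivationV DM) ?(has_value_neq0 vz) // Dvar mulrN.
have vD : has_value v (D (cst b / z)) (- (iota b * (ev v (f i2) / a2 ^+ 2))).
  rewrite Dbz; apply: has_valueN.
  apply: has_valueM; first exact: has_value_const.
  apply: has_valueM; first exact: has_value_poly.
  by apply: has_valueV; rewrite ?expf_neq0 //; apply: has_valueX.
split.
- apply: (chart_value uw e0); rewrite u0 DD Dvar.
  exact: (has_valueD tau_inj (has_value_poly _ _ _)).
- apply: (chart_value uw e1); rewrite u1 DD Dvar.
  exact: (has_valueD tau_inj (has_value_poly _ _ _)).
- by apply: (chart_value uw e2); rewrite u2 Dvar; apply: has_value_poly.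
Qed.

End Translation.
End Charts.

(** * Restriction to a generic plane x - y = d *)

Section Slice.
Variables (F k : fieldType) (iota : {rmorphism F -> k}) (d : k).
Local Notation A := {mpoly F[3]}.
Local Notation ev v := (mmap iota v).
Implicit Types (p : A).

(** Restriction to the plane x - y = d, with z as outer variable and x as inner
    one. *)
Definition slice : A -> {poly {poly k}} :=
  mmap ((@polyC {poly k} \o @polyC k) \o iota)
    (vec3 ('X%:P) (('X - d%:P)%:P) 'X).

Lemma slice_eval p x z : (slice p).[z%:P].[x] = ev (vec3 x (x - d) z) p.
Proof.
pose phi : {rmorphism {poly {poly k}} -> k} := horner_eval x \o horner_eval z%:P.
rewrite -[LHS]/(phi (slice p)) rmorph_mmap; apply: eq_mmap => [c|] /=.
  by rewrite /horner_eval !hornerC.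
apply: vec3_ind; rewrite /= /horner_eval /vec3 !(tnth_nth 0) /=.
- by rewrite hornerC hornerX.
- by rewrite hornerC hornerXsubC.
- by rewrite hornerX hornerC.
Qed.

(** On the plane the divisors x = e and y = e' of the chart become the poles c0
    and c1 of one variable x. At one of the two poles the term of the chart coming
    from the other is regular, so that each pole can be treated alone. *)
Section ShiftPoles.
Variables (e e' b : F) (f : 'I_3 -> A).
Hypothesis values : exists g0 g1 g2 : A, forall a0 a1 a2 : k,
  a0 != iota e -> a1 != iota e' ->
  let v := vec3 a0 a1 a2 in
  let w := vec3 (a0 - iota e) (a1 - iota e')
    (a2 - iota b * ((a0 - iota e)^-1 + (a1 - iota e')^-1)) in
  [/\ ev v (f i0) = ev w g0, ev v (f i1) = ev w g1
    & ev v (f i2) + iota b * (ev v (f i0) / (a0 - iota e) ^+ 2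
        + ev v (f i1) / (a1 - iota e') ^+ 2) = ev w g2].
Let c0 := iota e.
Let c1 := d + iota e'.
Hypothesis c01 : c0 != c1.

(** The chart coordinates of the point z = s + b / (x - c), where c' is the
    other pole. *)
Let curve c' s x : 'I_3 -> k :=
  vec3 (x - iota e) (x - d - iota e') (s - iota b / (x - c')).

Let regular_curve c c' s i : c != c' -> regular_at c (fun x => curve c' s x i).
Proof.
move=> cc'; move: i; apply: vec3_ind; rewrite /curve /vec3 /tnth /=.
- by apply: regular_ext (regular_poly c ('X - (iota e)%:P)) => x; rewrite hornerXsubC.
- apply: regular_ext (regular_poly c ('X - d%:P - (iota e')%:P)) => x.
  by rewrite hornerD hornerN hornerC hornerXsubC.
apply: regularD; first exact: regular_const.
apply/regularN/regularM; first exact: regular_const.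
apply: regular_ext (regularV (p := 'X - c'%:P) _) => [x|].
  by rewrite hornerXsubC.
by rewrite hornerXsubC subr_eq0.
Qed.

Lemma shift_curve : exists g0 g1 g2 : A, forall c c' s x,
  (c = c0 /\ c' = c1) \/ (c = c1 /\ c' = c0) -> x != c -> x != c' ->
  let z := (s + iota b / (x - c))%:P in
  let w := curve c' s x in
  [/\ (slice (f i0)).[z].[x] = ev w g0, (slice (f i1)).[z].[x] = ev w g1
    & (slice (f i2)).[z].[x] + iota b * ((slice (f i0)).[z].[x] / (x - c0) ^+ 2
        + (slice (f i1)).[z].[x] / (x - c1) ^+ 2) = ev w g2].
Proof.
have [g0 [g1 [g2 h]]] := values; exists g0, g1, g2 => c c' s x cc xc xc' z w.
have c1E : x - d - iota e' = x - c1 by rewrite /c1 opprD addrA.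
have x0 : x != iota e by case: cc xc xc' => -[-> ->].
have x1 : x - d != iota e'.
  by rewrite -subr_eq0 c1E subr_eq0; case: cc xc xc' => -[-> ->].
have := h x (x - d) (s + iota b / (x - c)) x0 x1.
rewrite /z !slice_eval c1E.
have -> : s + iota b / (x - c) - iota b * ((x - iota e)^-1 + (x - c1)^-1) =
    s - iota b / (x - c').
  rewrite -addrA; congr (_ + _); rewrite mulrDr opprD.
  by case: cc => -[-> ->]; [rewrite addrA subrr sub0r | rewrite addrC subrK].
by rewrite -c1E.
Qed.

Lemma shift_pole0 c : c \in [:: c0; c1] ->
  pole_free 0 (slice (f i0)) c (iota b) /\ pole_free 0 (slice (f i1)) c (iota b).
Proof.
rewrite !inE => /orP cc; have [g0 [g1 [g2 h]]] := shift_curve.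
have [c' cc' cne] : exists2 c', (c = c0 /\ c' = c1) \/ (c = c1 /\ c' = c0) & c != c'.
  case: cc => /eqP->; first by exists c1 => //; left.
  by exists c0; [right | rewrite eq_sym].
have N0 : ('X - c'%:P).[c] != 0 by rewrite hornerXsubC subr_eq0.
split=> s.
- apply: (regular_near N0 _ (regular_mmap iota g0 (fun i => regular_curve s i cne))).
  move=> x xc; rewrite hornerXsubC subr_eq0 => xc'.
  by have [-> _ _] := h c c' s x cc' xc xc'; rewrite expr0 divr1.
- apply: (regular_near N0 _ (regular_mmap iota g1 (fun i => regular_curve s i cne))).
  move=> x xc; rewrite hornerXsubC subr_eq0 => xc'.
  by have [_ -> _] := h c c' s x cc' xc xc'; rewrite expr0 divr1.
Qed.

Let regular_square_inv (c c' : k) : c != c' -> regular_at c (fun x => (x - c') ^- 2).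
Proof.
move=> cc'; apply: regular_ext (regularV (p := ('X - c'%:P) ^+ 2) _) => [x|].
  by rewrite horner_exp hornerXsubC.
by rewrite horner_exp hornerXsubC expf_neq0 ?subr_eq0.
Qed.

Let vert_eval (c : k) (F0 F3 : {poly {poly k}}) (z x : k) : x != c ->
  ((('X - c%:P) ^+ 2)%:P * F3 + (iota b)%:P%:P * F0).[z%:P].[x] / (x - c) ^+ 2 =
  F3.[z%:P].[x] + iota b * (F0.[z%:P].[x] / (x - c) ^+ 2).
Proof.
rewrite -subr_eq0 => xc.
by rewrite !(hornerD, hornerM, hornerN, hornerC, hornerX); field.
Qed.

Lemma shift_pole2_0 : pole_free 2
  ((('X - c0%:P) ^+ 2)%:P * slice (f i2) + (iota b)%:P%:P * slice (f i0)) c0 (iota b).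
Proof.
move=> s; have [g0 [g1 [g2 h]]] := shift_curve.
have N0 : ('X - c1%:P).[c0] != 0 by rewrite hornerXsubC subr_eq0.
have rg g := regular_mmap iota g (fun i => regular_curve s i c01).
apply: (regular_near N0 _ (regularD (rg g2) (regularN (regularM
  (regular_const c0 (iota b)) (regularM (rg g1) (regular_square_inv c01)))))).
move=> x xc; rewrite hornerXsubC subr_eq0 => xc'.
have [_ <- <-] := h c0 c1 s x (or_introl (conj erefl erefl)) xc xc'.
by rewrite vert_eval // mulrDr addrA addrK.
Qed.

Lemma shift_pole2_1 : pole_free 2
  ((('X - c1%:P) ^+ 2)%:P * slice (f i2) + (iota b)%:P%:P * slice (f i1)) c1 (iota b).
Proof.
move=> s; have [g0 [g1 [g2 h]]] := shift_curve.
have c10 : c1 != c0 by rewrite eq_sym.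
have N0 : ('X - c0%:P).[c1] != 0 by rewrite hornerXsubC subr_eq0.
have rg g := regular_mmap iota g (fun i => regular_curve s i c10).
apply: (regular_near N0 _ (regularD (rg g2) (regularN (regularM
  (regular_const c1 (iota b)) (regularM (rg g0) (regular_square_inv c10)))))).
move=> x xc; rewrite hornerXsubC subr_eq0 => xc'.
have [<- _ <-] := h c1 c0 s x (or_intror (conj erefl erefl)) xc xc'.
by rewrite vert_eval // mulrDr addrCA -addrA addrC addrNK addrC.
Qed.
End ShiftPoles.

(** Now z = t is the parameter, and x = s - b / t runs to infinity at t = 0. *)
Section TranslationPoles.
Variables (b : F) (f : 'I_3 -> A).
Hypothesis values : exists g0 g1 g2 : A, forall a0 a1 a2 : k,
  a2 != 0 ->
  let v := vec3 a0 a1 a2 in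
  let w := vec3 (a0 + iota b / a2) (a1 + iota b / a2) a2 in
  [/\ ev v (f i0) - iota b * (ev v (f i2) / a2 ^+ 2) = ev w g0,
      ev v (f i1) - iota b * (ev v (f i2) / a2 ^+ 2) = ev w g1
    & ev v (f i2) = ev w g2].

Let regular_line s i : regular_at 0 (fun t => vec3 s (s - d) t i).
Proof.
move: i; apply: vec3_ind; rewrite /vec3 /tnth /=; try exact: regular_const.
by apply: regular_ext (regular_poly 0 'X) => x; rewrite hornerX.
Qed.

Lemma translation_curve : exists g0 g1 g2 : A, forall s t, t != 0 ->
  let x := s + - iota b / (t - 0) in let w := vec3 s (s - d) t in
  [/\ (slice (f i0)).[t%:P].[x] - iota b * ((slice (f i2)).[t%:P].[x] / t ^+ 2)
        = ev w g0,
      (slice (f i1)).[t%:P].[x] - iota b * ((slice (f i2)).[t%:P].[x] / t ^+ 2)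
        = ev w g1
    & (slice (f i2)).[t%:P].[x] = ev w g2].
Proof.
have [g0 [g1 [g2 h]]] := values; exists g0, g1, g2 => s t t0 x w.
have := h x (x - d) t t0; rewrite !slice_eval.
have e1 : x + iota b / t = s by rewrite /x subr0 mulNr subrK.
have -> : x - d + iota b / t = s - d by rewrite addrAC e1.
by rewrite e1.
Qed.

Let reg g s := regular_mmap iota g (regular_line s).

Lemma translation_pole0_diff :
  pole_free 0 (swapXY (slice (f i0) - slice (f i1))) 0 (- iota b).
Proof.
move=> s; have [g0 [g1 [g2 h]]] := translation_curve.
apply: (regular_near (N := 1) _ _ (regularD (reg g0 s) (regularN (reg g1 s)))).
  by rewrite hornerC oner_neq0.
move=> t t0 _; have [<- <- _] := h s t t0.
rewrite horner2_swapXY expr0 divr1 !hornerD !hornerN.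
by rewrite opprB addrA subrK.
Qed.

Lemma translation_pole0 : pole_free 0 (swapXY (slice (f i2))) 0 (- iota b).
Proof.
move=> s; have [g0 [g1 [g2 h]]] := translation_curve.
apply: (regular_near (N := 1) _ _ (reg g2 s)); first by rewrite hornerC oner_neq0.
move=> t t0 _; have [_ _ <-] := h s t t0.
by rewrite horner2_swapXY expr0 divr1.
Qed.

Lemma translation_pole2 : pole_free 2
  (swapXY ('X^2 * slice (f i0) - (iota b)%:P%:P * slice (f i2))) 0 (- iota b).
Proof.
move=> s; have [g0 [g1 [g2 h]]] := translation_curve.
apply: (regular_near (N := 1) _ _ (reg g0 s)); first by rewrite hornerC oner_neq0.
move=> t t0 _; have [<- _ _] := h s t t0.
rewrite horner2_swapXY subr0 !(hornerD, hornerM, hornerN, hornerC, hornerX).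
by field.
Qed.
End TranslationPoles.
End Slice.

Section SliceDegree.
Variables (F k : fieldType) (iota : {rmorphism F -> k}) (d : k).
Implicit Types (G : {poly {poly k}}) (h : {poly F}).

(** Total degree at most m in x, z and d together: the coefficients of the slice
    are polynomials in d, whose degree is what the final argument needs. *)
Definition degree_le m G := forall i j, exists h : {poly F},
  (size h <= m.+1 - (i + j))%N /\ G`_i`_j = (map_poly iota h).[d].

Lemma degree_leD m G G' : degree_le m G -> degree_le m G' -> degree_le m (G + G').
Proof.
move=> H H' i j; have [h [sh e]] := H i j; have [h' [sh' e']] := H' i j.
exists (h + h'); split; last by rewrite !coefD e e' rmorphD hornerD.
by rewrite (leq_trans (size_polyD _ _)) // geq_max sh.
Qed.

Lemma degree_leZ m a G : degree_le m G -> degree_le m ((iota a)%:P%:P * G).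
Proof.
move=> H i j; have [h [sh e]] := H i j.
exists (a *: h); split; first exact: leq_trans (size_scale_leq _ _) sh.
by rewrite !coefCM e -mul_polyC rmorphM /= map_polyC hornerM hornerC.
Qed.

Lemma degree_le_widen m m' G : (m <= m')%N -> degree_le m G -> degree_le m' G.
Proof.
move=> mm' H i j; have [h [sh e]] := H i j; exists h; split=> //.
by apply: leq_trans sh _; lia.
Qed.

Lemma degree_le0 m : degree_le m 0.
Proof. by move=> i j; exists 0; rewrite size_poly0 rmorph0 horner0 !coef0. Qed.

Lemma degree_le1 : degree_le 0 1.
Proof.
case=> [|i] j; last first.
  by exists 0; rewrite size_poly0 rmorph0 horner0 coef1 coef0.
case: j => [|j]; first by exists 1; rewrite size_poly1 rmorph1 hornerC !coef1.
by exists 0; rewrite size_poly0 rmorph0 horner0 !coef1.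
Qed.

Lemma degree_leMz m G : degree_le m G -> degree_le m.+1 ('X * G).
Proof.
move=> H i j; rewrite coefXM; case: i => [|i].
  by exists 0; rewrite size_poly0 rmorph0 horner0 coef0.
by have [h [sh e]] := H i j; exists h.
Qed.

Lemma degree_leMx m G : degree_le m G -> degree_le m.+1 ('X%:P * G).
Proof.
move=> H i j; rewrite coefCM coefXM; case: j => [|j].
  by exists 0; rewrite size_poly0 rmorph0 horner0.
have [h [sh e]] := H i j; exists h; split=> //.
by apply: leq_trans sh _; lia.
Qed.

Lemma degree_leMd m G : degree_le m G -> degree_le m.+1 (d%:P%:P * G).
Proof.
move=> H i j; have [h [sh e]] := H i j; exists ('X * h); split.
  have [->|h0] := eqVneq h 0; first by rewrite mulr0 size_poly0.
  rewrite mulrC size_mulX //; move: sh; rewrite -size_poly_gt0 in h0.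
  by move: (size h) h0 => n; lia.
by rewrite !coefCM e rmorphM /= map_polyX hornerM hornerX.
Qed.

Lemma degree_leMy m G : degree_le m G -> degree_le m.+1 (('X - d%:P)%:P * G).
Proof.
move=> H; rewrite polyCB mulrBl -mulNr -polyCN -[- d%:P]polyCN.
apply: degree_leD; first exact: degree_leMx.
move=> i j; have [h [sh e]] := degree_leMd H i j.
exists (- h); split; first by rewrite size_polyN.
by rewrite !coefCM mulNr -!coefCM e rmorphN hornerN.
Qed.

Lemma slice_degree m (p : {mpoly F[3]}) :
  (msize p <= m.+1)%N -> degree_le m (slice iota d p).
Proof.
move=> sp; rewrite /slice /mmap big_seq.
elim/big_rec: _ => [|n G np HG]; first exact: degree_le0.
apply: degree_leD HG; apply: degree_leZ.
have nm : (mdeg n <= m)%N by rewrite -ltnS (leq_trans (msize_mdeg_lt np)).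
apply: degree_le_widen nm _.
rewrite mdegE /mmap1 !big_ord_recl !big_ord0 /vec3 /tnth /= mulr1 addn0.
have H3 a : degree_le a ('X ^+ a).
  elim: a => [|a IH]; first exact: degree_le1.
  by rewrite exprS; apply: degree_leMz.
have H2 b a : degree_le (b + a) (('X - d%:P)%:P ^+ b * 'X ^+ a).
  elim: b => [|b IH]; first by rewrite expr0 mul1r.
  by rewrite exprS -mulrA; apply: degree_leMy.
elim: (n ord0) => [|a IH]; first by rewrite expr0 mul1r add0n; apply: H2.
by rewrite exprS -mulrA; apply: degree_leMx.
Qed.

End SliceDegree.

Section D4Morphism.
Variables (A B : comNzRingType) (phi : {rmorphism A -> B}).
Variables (e a0 a1 a2 a3 a4 x y z : A).

Lemma rmorph_D4_P : phi (D4_P e a0 a1 a2 a3 a4 x y z) =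
  D4_P (phi e) (phi a0) (phi a1) (phi a2) (phi a3) (phi a4) (phi x) (phi y) (phi z).
Proof. by rewrite /D4_P; ring. Qed.

Lemma rmorph_D4_Q : phi (D4_Q e a0 a1 a2 a3 a4 x y z) =
  D4_Q (phi e) (phi a0) (phi a1) (phi a2) (phi a3) (phi a4) (phi x) (phi y) (phi z).
Proof. by rewrite /D4_Q; ring. Qed.

Lemma rmorph_D4_R : phi (D4_R e a0 a1 a2 a3 a4 x y z) =
  D4_R (phi e) (phi a0) (phi a1) (phi a2) (phi a3) (phi a4) (phi x) (phi y) (phi z).
Proof. by rewrite /D4_R; ring. Qed.
End D4Morphism.

(** * Rigidity over a differential field *)

(** The differential field is F, and K is a field that contains the polynomials in
    x, y, z, such as their field of fractions. The plane is x - y = d for d the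
    element x - y of K, which is transcendental over F; this makes all the poles
    distinct, and evaluation at x and z recovers a polynomial from its slice. *)
Section Rigidity.
Variables (F K : fieldType).
Hypothesis char0 : [pchar K] =i pred0.
Local Notation A := {mpoly F[3]}.
Variables (tau : {rmorphism A -> K}) (D : K -> K).
Hypothesis tau_inj : injective tau.
Hypothesis DD : forall u v, D (u + v) = D u + D v.
Hypothesis DM : forall u v, D (u * v) = D u * v + u * D v.
Variable f : 'I_3 -> A.
Hypothesis Dvar : forall i, D (tau 'X_i) = tau (f i).

Local Notation cst e := (tau e%:MP).
Local Notation x := (tau 'X_i0).
Local Notation y := (tau 'X_i1).
Local Notation z := (tau 'X_i2).

Variables (e b0 b1 b2 : F).
Hypothesis Dcst : forall a, a \in [:: 0; 1; e; b0; b1; b2] -> D (cst a) = 0.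
Hypothesis sum_b : b0 + b1 + b2 = 2^-1.
Hypotheses (e_neq0 : e != 0) (e_neq1 : e != 1) (e_neqN1 : e != -1).
Hypotheses (b0_neq0 : b0 != 0) (b1_neq0 : b1 != 0) (b2_neq0 : b2 != 0).
Hypothesis deg_f : forall i, (msize (f i) <= 7)%N.

Variables u1 u2 u3 : 'I_3 -> K.
Hypothesis u1E : [/\ u1 i0 = x - cst e, u1 i1 = y - cst 1
  & u1 i2 = z - cst b0 * ((x - cst e)^-1 + (y - cst 1)^-1)].
Hypothesis u2E : [/\ u2 i0 = x + cst b1 / z, u2 i1 = y + cst b1 / z & u2 i2 = z].
Hypothesis u3E : [/\ u3 i0 = x - cst 0, u3 i1 = y - cst 0
  & u3 i2 = z - cst b2 * ((x - cst 0)^-1 + (y - cst 0)^-1)].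
Hypothesis poly1 : polynomial_system tau D u1.
Hypothesis poly2 : polynomial_system tau D u2.
Hypothesis poly3 : polynomial_system tau D u3.

Let iota : {rmorphism F -> K} := tau \o @mpolyC 3 F.
Let d : K := x - y.

(** Specialize x to t and y to 0. *)
Let d_transcendental (h : {poly F}) : (map_poly iota h).[d] = 0 -> forall t, h.[t] = 0.
Proof.
move=> h0 t.
pose h' : A := (map_poly (@mpolyC 3 F) h).['X_i0 - 'X_i1].
have th' : tau h' = 0.
  by rewrite -h0 /d -rmorphB /h' -horner_map -map_poly_comp.
have h'0 : h' = 0 by apply: tau_inj; rewrite th' rmorph0.
pose phi : {rmorphism A -> F} := mmap idfun (vec3 t 0 0).
have : phi h' = 0 by rewrite h'0 rmorph0.
rewrite /h' -horner_map -map_poly_comp rmorphB /= !mmapX !mmap1U.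
rewrite /vec3 /tnth /= subr0 => <-; congr (_.[_]).
by rewrite map_poly_id // => a _ /=; rewrite mmapC.
Qed.

Let d_neq a : d != iota a.
Proof.
apply/eqP => da; have := @d_transcendental ('X - a%:P) _ (a + 1).
rewrite hornerXsubC addrAC subrr add0r rmorphB /= map_polyX map_polyC /=.
rewrite hornerXsubC da subrr => /(_ erefl) /eqP.
by rewrite oner_eq0.
Qed.

Let two0 : 2 != 0 :> F.
Proof.
rewrite -(fmorph_eq0 iota) rmorph_nat.
by rewrite (pcharf0P K).1.
Qed.

Let w (c : K) : K := if c \in [:: iota 0; d] then iota b2 else iota b0.

Let cs := [:: iota 0; iota e; d; d + iota 1].

Let uniq_cs : uniq cs.
Proof.
have iota_neq a b : a != b -> iota a != iota b by rewrite (inj_eq (fmorph_inj iota)).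
have d1 a : iota a != d + iota 1.
  by rewrite eq_sym -(inj_eq (addIr (- iota 1))) addrK -rmorphB d_neq.
have d0 a : iota a != d by rewrite eq_sym d_neq.
have dd1 : d != d + iota 1.
  by rewrite -subr_eq0 opprD addrA subrr sub0r oppr_eq0 rmorph1 oner_neq0.
by rewrite /= !inE !negb_or !d1 !d0 dd1 iota_neq // eq_sym.
Qed.

Let G i : {poly {poly K}} := slice iota d (f i).

Let deg_G i j l : (6 < j + l)%N -> (G i)`_j`_l = 0.
Proof.
move=> jl; have [h [sh ->]] := slice_degree iota d (deg_f i) j l.
have /eqP : size h = 0%N by apply/eqP; rewrite -leqn0; apply: leq_trans sh _; lia.
by rewrite size_poly_eq0 => /eqP->; rewrite rmorph0 horner0.
Qed.

Let shift_data e1 e1' b u :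
  [/\ D (cst e1) = 0, D (cst e1') = 0 & D (cst b) = 0] ->
  [/\ u i0 = x - cst e1, u i1 = y - cst e1'
    & u i2 = z - cst b * ((x - cst e1)^-1 + (y - cst e1')^-1)] ->
  polynomial_system tau D u ->
  let c0 := iota e1 in let c1 := d + iota e1' in
  [/\ forall c, c \in [:: c0; c1] ->
        pole_free 0 (G i0) c (iota b) /\ pole_free 0 (G i1) c (iota b),
      pole_free 2 ((('X - c0%:P) ^+ 2)%:P * G i2 + (iota b)%:P%:P * G i0)
        c0 (iota b)
    & pole_free 2 ((('X - c1%:P) ^+ 2)%:P * G i2 + (iota b)%:P%:P * G i1)
        c1 (iota b)].
Proof.
move=> [D1 D2 D3] [h0 h1 h2] hu c0 c1.
have V := shift_chart_values iota tau_inj DD DM Dvar D1 D2 D3 h0 h1 h2 hu.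
have c01 : c0 != c1.
  by rewrite eq_sym -(inj_eq (addIr (- iota e1'))) addrK -rmorphB d_neq.
split=> [c||]; [exact: (shift_pole0 V c01) | exact: (shift_pole2_0 V c01)
  | exact: (shift_pole2_1 V c01)].
Qed.

Let eval_generic p : mmap iota (vec3 x (x - d) z) p = tau p.
Proof.
rewrite -[in RHS](mmap_id p) rmorph_mmap; apply: eq_mmap => //.
by apply: vec3_ind => //; rewrite /vec3 /tnth /= /d subKr.
Qed.

Let scaled_tau a (p : A) : tau (a *: p) = iota a * tau p.
Proof. by rewrite -mul_mpolyC rmorphM. Qed.

(** Both l and the jump are polynomials h, g - g' in d, and h has degree at most 1.
    The relation between them, read at d = (e - 1) / 2, shows that h vanishes
    there, as none of d, d - e, d + 1, d + 1 - e does when e is not 1 or -1. So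
    h is a multiple of 2 d + 1 - e, by a factor c in F, and everything else
    follows from l. *)
Lemma rigidity : exists c : F,
  [/\ f i0 = - (c / 2) *: D4_P e%:MP b0%:MP b2%:MP b1%:MP b0%:MP b2%:MP 'X_i0 'X_i1 'X_i2,
      f i1 = (c / 2) *: D4_Q e%:MP b0%:MP b2%:MP b1%:MP b0%:MP b2%:MP 'X_i0 'X_i1 'X_i2
    & f i2 = - (c / 2) *: D4_R e%:MP b0%:MP b2%:MP b1%:MP b0%:MP b2%:MP 'X_i0 'X_i1 'X_i2].
Proof.
have D0 : D (cst 0) = 0 by rewrite Dcst ?inE ?eqxx.
have D1 : D (cst 1) = 0 by rewrite Dcst ?inE ?eqxx ?orbT.
have De : D (cst e) = 0 by rewrite Dcst ?inE ?eqxx ?orbT.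
have Db0 : D (cst b0) = 0 by rewrite Dcst ?inE ?eqxx ?orbT.
have Db1 : D (cst b1) = 0 by rewrite Dcst ?inE ?eqxx ?orbT.
have Db2 : D (cst b2) = 0 by rewrite Dcst ?inE ?eqxx ?orbT.
have [p1 p1x p1y] := shift_data (And3 De D1 Db0) u1E poly1.
have [p3 p3x p3y] := shift_data (And3 D0 D0 Db2) u3E poly3.
have [h20 h21 h22] := u2E.
have V2 := translation_chart_values iota tau_inj DD DM Dvar Db1 h20 h21 h22 poly2.
have t12 := translation_pole0_diff d V2.
have t3 := translation_pole0 d V2.
have t13 := translation_pole2 d V2.
have dd0 : d + iota 0 = d by rewrite rmorph0 addr0.
rewrite dd0 in p3 p3y.
have w0 c : w c != 0 by rewrite /w; case: ifP; rewrite fmorph_eq0.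
have [n1 n2 n3 n4] : [/\ iota e != iota 0, iota e != d, d + iota 1 != iota 0
    & d + iota 1 != d].
  have := uniq_cs; rewrite /= !inE !negb_or => /and4P[/and3P[? ? ?] /andP[? ?] ? _].
  by split; rewrite // eq_sym.
have w1 : w (iota 0) = iota b2 by rewrite /w mem_head.
have w2 : w (iota e) = iota b0 by rewrite /w !inE (negPf n1) (negPf n2).
have w3 : w d = iota b2 by rewrite /w !inE eqxx orbT.
have w4 : w (d + iota 1) = iota b0 by rewrite /w !inE (negPf n3) (negPf n4).
have p0 c : c \in cs -> pole_free 0 (G i0) c (w c) /\ pole_free 0 (G i1) c (w c).
  rewrite !inE => /or4P[] /eqP->.
  - by rewrite w1; apply: p3; rewrite mem_head.
  - by rewrite w2; apply: p1; rewrite mem_head.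
  - by rewrite w3; apply: p3; rewrite !inE eqxx orbT.
  - by rewrite w4; apply: p1; rewrite !inE eqxx orbT.
have px c : c \in [:: iota 0; iota e] -> pole_free 2
   ((('X - c%:P) ^+ 2)%:P * G i2 + (w c)%:P%:P * G i0) c (w c).
  by rewrite !inE => /orP[] /eqP->; rewrite ?w1 ?w2.
have py c : c \in [:: d; d + iota 1] -> pole_free 2
   ((('X - c%:P) ^+ 2)%:P * G i2 + (w c)%:P%:P * G i1) c (w c).
  by rewrite !inE => /orP[] /eqP->; rewrite ?w3 ?w4.
have ib1 : iota b1 != 0 by rewrite fmorph_eq0.
have := planar_normal_form char0 uniq_cs ib1 w0 (@deg_G i0) (@deg_G i1) (@deg_G i2)
  (fun c h => (p0 c h).1) (fun c h => (p0 c h).2) px py t12 t3 t13.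
have z0 : iota 0 = 0 := rmorph0 iota; have z1 : iota 1 = 1 := rmorph1 iota.
rewrite !z0 !z1 in w1 w4 *; set q := \prod_(c <- _) _.
set Ap := (G i0)`_0; set l := (G i0)`_1`_4; set J := (G i0)`_0`_0 - _.
move=> [[E0 E1 E2] [sA A3 Ax Ay]].
have twoK : 2 != 0 :> K by rewrite (pcharf0P K).1.
have sumK : iota b0 + iota b1 + iota b2 = 2^-1.
  by rewrite -!rmorphD sum_b fmorphV rmorph_nat.
have eK : iota e != 0 by rewrite fmorph_eq0.
have d0 : d != 0 by rewrite -z0 d_neq.
have d1 : d + 1 != 0 by rewrite addr_eq0 -z1 -rmorphN d_neq.
have de : d - iota e != 0 by rewrite subr_eq0 d_neq.
have d1e : d + 1 - iota e != 0.
  by rewrite -addrA addr_eq0 opprB -z1 -rmorphB d_neq.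
have A_0 : Ap.[0] = - (iota b2 * (l / 2) * q^`().[0]).
  by rewrite -w1; apply: Ax; rewrite mem_head.
have A_e : Ap.[iota e] = - (iota b0 * (l / 2) * q^`().[iota e]).
  by rewrite -w2; apply: Ax; rewrite !inE eqxx orbT.
have A_d : Ap.[d] = J - iota b2 * (l / 2) * q^`().[d].
  by rewrite -w3; apply: Ay; rewrite mem_head.
have A_d1 : Ap.[d + 1] = J - iota b0 * (l / 2) * q^`().[d + 1].
  by rewrite -w4; apply: Ay; rewrite !inE eqxx orbT.
have jump := jump_relation twoK sumK eK d0 d1 de d1e sA A3 A_0 A_e A_d A_d1.
have [h [sh' lE]] := slice_degree iota d (deg_f i0) 1 4.
have sh : (size h <= 2)%N := sh'.
have [g [_ gE]] := slice_degree iota d (deg_f i0) 0 0.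
have [g' [_ g'E]] := slice_degree iota d (deg_f i1) 0 0.
have hE t : h.[t] = h`_0 + h`_1 * t.
  by rewrite (horner_coef_wide _ sh) !big_ord_recr big_ord0 /= add0r expr0 expr1 mulr1.
pose t := (e - 1) / 2.
have ht : h.[t] = 0.
  (* H vanishes at d by the jump relation, hence identically. *)
  pose H := (g - g') * (2%:P * 'X + (1 - e)%:P)
    + (2^-1)%:P * h * ('X * ('X - e%:P) * ('X + 1) * ('X + 1 - e%:P)).
  have /d_transcendental/(_ t) : (map_poly iota H).[d] = 0.
    pose at_d : {rmorphism {poly F} -> K} := horner_eval d \o map_poly iota.
    have atC a : at_d a%:P = iota a by rewrite /= /horner_eval map_polyC hornerC.
    have atX : at_d 'X = d by rewrite /= /horner_eval map_polyX hornerX.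
    have atE p : at_d p = (map_poly iota p).[d] by [].
    rewrite -[LHS]/(at_d H) /H !(rmorphD, rmorphN, rmorphM, rmorph1) !atC atX.
    rewrite !atE -gE -g'E -lE -/l -/J ?z1 ?fmorphV ?rmorph_nat.
    rewrite addrA jump; field.
    by [].
  rewrite /H !(hornerD, hornerM, hornerN, hornerC, hornerX).
  have -> : 2 * t + (1 - e) = 0 by rewrite /t; field.
  rewrite mulr0 add0r => /eqP; rewrite mulf_eq0 mulf_eq0 invr_eq0 (negPf two0) /=.
  have half_neq0 (a : F) : a != 0 -> a / 2 != 0.
    by move=> a0; rewrite mulf_neq0 // invr_eq0.
  have t0 : t != 0 by rewrite half_neq0 // subr_eq0.
  have te : t - e != 0.
    have -> : t - e = - ((e + 1) / 2) by rewrite /t; field.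
    by rewrite oppr_eq0 half_neq0 // addr_eq0.
  have t1 : t + 1 != 0.
    have -> : t + 1 = (e + 1) / 2 by rewrite /t; field.
    by rewrite half_neq0 // addr_eq0.
  have t1e : t + 1 - e != 0.
    have -> : t + 1 - e = - ((e - 1) / 2) by rewrite /t; field.
    by rewrite oppr_eq0 half_neq0 // subr_eq0.
  by rewrite (negPf (mulf_neq0 (mulf_neq0 (mulf_neq0 t0 te) t1) t1e)) orbF => /eqP.
exists (h`_1 / 2); set c := h`_1 / 2.
have lc : l = iota c * (2 * d + 1 - iota e).
  have -> : l = iota h`_0 + iota h`_1 * d.
    have ch i : (map_poly iota h)`_i = iota h`_i := coef_map iota h i.
    rewrite /l lE (horner_coef_wide _ (leq_trans (size_poly _ _) sh)).
    by rewrite big_ord_recr big_ord1 !ch expr0 mulr1 expr1.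
  have -> : h`_0 = - (c * (e - 1)).
    by move/eqP: ht; rewrite hE addr_eq0 => /eqP->; rewrite /t /c; field.
  have -> : h`_1 = 2 * c by rewrite /c; field.
  by rewrite rmorphN !rmorphM rmorphB z1 rmorph_nat; ring.
have d2 : 2 * d + 1 - iota e != 0.
  have -> : 2 * d + 1 - iota e = 2 * (d - iota t).
    rewrite /t; have -> : iota ((e - 1) / 2) = (iota e - 1) / 2.
      by rewrite rmorphM rmorphB z1 fmorphV rmorph_nat.
    by field.
  by rewrite mulf_neq0 // subr_eq0 d_neq.
have xd : x - d = y by rewrite /d subKr.
have tau_slice i : tau (f i) = (G i).[z%:P].[x] by rewrite slice_eval eval_generic.
have c2 : iota (c / 2) = iota c / 2 by rewrite rmorphM fmorphV rmorph_nat.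
have G0E : (G i0).[z%:P].[x] = Ap.[x] + l * q.[x] * z.
  rewrite E0 hornerD hornerC hornerM hornerX hornerC hornerD !hornerM hornerC.
  by rewrite hornerZ.
have G2E : (G i2).[z%:P].[x] =
    - (iota b1 ^+ 2 * l) * x + (iota b1 ^+ 2 * l * q`_3 / 2 - iota b1 * Ap`_2)
    - Ap^`().[x] * z - l / 2 * q^`().[x] * z ^+ 2.
  rewrite E2; set a1 := _ ^+ 2 * l; set a0 := _ - _ * _; set q' := q^`().
  by rewrite !(hornerD, hornerN, hornerC, hornerX, hornerM, hornerZ).
split; apply: tau_inj; rewrite scaled_tau tau_slice.
- rewrite G0E rmorph_D4_P rmorphN c2.
  have := first_component twoK sumK eK d0 d1 de d1e sA A3 A_0 A_e A_d A_d1 d2 lc x z.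
  by rewrite xd => <-.
- rewrite E1 hornerD hornerN hornerD hornerN !hornerC G0E rmorph_D4_Q c2.
  have := second_component twoK sumK eK d0 d1 de d1e sA A3 A_0 A_e A_d A_d1 d2 lc x z.
  by rewrite xd => <-; rewrite addrAC.
- rewrite G2E rmorph_D4_R rmorphN c2.
  have := third_component twoK sumK eK d0 d1 de d1e sA A3 A_0 A_e A_d A_d1 d2 lc x z.
  by rewrite xd => <-.
Qed.
End Rigidity.

(** * The field C(t) and the conclusion *)

Lemma sum_of_inverses (k : fieldType) (b u v : k) :
  u != 0 -> v != 0 -> b * (u + v) / (u * v) = b * (u^-1 + v^-1).
Proof. by move=> u0 v0; field; rewrite u0 v0. Qed.

Lemma pchar0_of_morphism (k K : fieldType) (phi : {rmorphism k -> K}) :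
  [pchar k] =i pred0 -> [pchar K] =i pred0.
Proof. by move=> k0 p; rewrite (fmorph_pchar phi). Qed.

Section Frac.
Variables (F : fieldType).
Local Notation A := {mpoly F[3]}.

Lemma tofrac_inj (B : idomainType) : injective (@tofrac B).
Proof. by move=> p q /eqP; rewrite tofrac_eq => /eqP. Qed.

Lemma var_neq_const (i : 'I_3) (c : F) : ('X_i)%:F - (c%:MP)%:F != 0 :> {fraction A}.
Proof.
rewrite -tofracB tofrac_eq0; apply/eqP => e.
have := congr1 (mcoeff U_(i)%MM) e.
rewrite mcoeffB mcoeffX eqxx mcoeffC mcoeff0.
by rewrite mnm1_eq0 mulr0 subr0 => /eqP; rewrite oner_eq0.
Qed.
End Frac.

Section Instance.
Variable R : realType.
Local Notation C := (complex R).

Lemma pchar0_Ct : [pchar Ct R] =i pred0.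
Proof.
apply: (pchar0_of_morphism (@tofrac {poly C} \o @polyC C)).
exact: Num.Theory.pchar_num.
Qed.

Lemma dCtD : forall a b : Ct R, dCt (a + b) = dCt a + dCt b.
Proof. exact: (frac_derD (@derivD C) (@derivM C)). Qed.

Lemma dCtM (a b : Ct R) : dCt (a * b) = dCt a * b + a * dCt b.
Proof. exact: (frac_derM (@derivM C)). Qed.

Lemma dCt_const (c : C) : dCt (constT c) = 0.
Proof.
rewrite /dCt /constT; etransitivity; first exact: (frac_der_tofrac (@derivM C)).
by rewrite derivC tofrac0.
Qed.

Let cT : {rmorphism C -> Ct R} := @tofrac {poly C} \o @polyC C.

Lemma time_der_const (f : 'I_3 -> Pxyz R) (c : C) : time_der f (constT c)%:MP%:F = 0.
Proof.
etransitivity; first exact: (frac_der_tofrac (total_derM dCtD dCtM f)).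
by rewrite (total_der_const dCtD) ?tofrac0 //; exact: dCt_const.
Qed.

Lemma time_der_var (f : 'I_3 -> Pxyz R) i : time_der f ('X_i)%:F = (f i)%:F.
Proof.
etransitivity; first exact: (frac_der_tofrac (total_derM dCtD dCtM f)).
by rewrite (total_der_var dCtD dCtM).
Qed.

Lemma system_up_to_scalar (eta beta0 beta1 beta2 : C) (f : 'I_3 -> Pxyz R) :
  eta != 0 -> eta != 1 -> eta != -1 ->
  beta0 != 0 -> beta1 != 0 -> beta2 != 0 -> beta0 + beta1 + beta2 = 2^-1 ->
  (forall i, msize (f i) <= 7)%N ->
  polynomial_in f (chart1 eta beta0) -> polynomial_in f (chart2 beta1) ->
  polynomial_in f (chart3 beta2) ->
  let D4 G := G (constP eta) (constP beta0) (constP beta2) (constP beta1)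
    (constP beta0) (constP beta2) (xP R) (yP R) (zP R) : Pxyz R in
  exists c : Ct R, [/\ f i0 = - (c / 2) *: D4 (@D4_P _),
    f i1 = (c / 2) *: D4 (@D4_Q _) & f i2 = - (c / 2) *: D4 (@D4_R _)].
Proof.
move=> e0 e1 eN1 b00 b10 b20 sum_b deg p1 p2 p3 D4.
have cT0 (a : C) : a != 0 -> constT a != 0 by move=> a0; rewrite (fmorph_eq0 cT).
have Dcst a : a \in [:: 0; 1; constT eta; constT beta0; constT beta1; constT beta2] ->
    time_der f (a%:MP)%:F = 0.
  rewrite -(rmorph0 cT) -(rmorph1 cT) !inE.
  by move=> /or4P[||| /or3P[]] /eqP->; exact: time_der_const.
have F0 (i : 'I_3) a : ('X_i)%:F - (a%:MP)%:F != 0 :> Fxyz R by exact: var_neq_const.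
have t1 : (1%:MP)%:F = 1 :> Fxyz R := rmorph1 (@tofrac (Pxyz R) \o @mpolyC 3 _).
have t0 : (0%:MP)%:F = 0 :> Fxyz R := rmorph0 (@tofrac (Pxyz R) \o @mpolyC 3 _).
have sub_t0 (u : Fxyz R) : u - (0%:MP)%:F = u by rewrite t0 subr0.
have chart1_third : chart1 eta beta0 i2 = (zP R)%:F - constF beta0 *
    (((xP R)%:F - constF eta)^-1 + ((yP R)%:F - (1%:MP)%:F)^-1).
  rewrite -sum_of_inverses ?F0 // t1 addrACA -opprD.
  by rewrite opprD addrA.
have chart3_third : chart3 beta2 i2 = (zP R)%:F - constF beta2 *
    (((xP R)%:F - (0%:MP)%:F)^-1 + ((yP R)%:F - (0%:MP)%:F)^-1).
  by rewrite -sum_of_inverses ?F0 // !sub_t0.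
apply: (@rigidity (Ct R) (Fxyz R)
  (pchar0_of_morphism (@tofrac (Pxyz R) \o @mpolyC 3 (Ct R)) pchar0_Ct)
  (@tofrac (Pxyz R)) (time_der f) (@tofrac_inj _)
  (frac_derD (total_derD dCtD f) (total_derM dCtD dCtM f))
  (frac_derM (total_derM dCtD dCtM f)) f (time_der_var f)
  (constT eta) (constT beta0) (constT beta1) (constT beta2) Dcst _ (cT0 _ e0) _ _
  (cT0 _ b00) (cT0 _ b10) (cT0 _ b20) deg
  (chart1 eta beta0) (chart2 beta1) (chart3 beta2)).
- by rewrite -!(rmorphD cT) sum_b fmorphV rmorph_nat.
- by rewrite -(rmorph1 cT) (inj_eq (fmorph_inj cT)).
- by rewrite -(rmorph1 cT) -(rmorphN cT) (inj_eq (fmorph_inj cT)).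
- by split; [| congr (_ - _); exact/esym/t1 | exact: chart1_third].
- by split.
- by split; [exact/esym/sub_t0 | exact/esym/sub_t0 | exact: chart3_third].
- exact: p1.
- exact: p2.
- exact: p3.
Qed.
End Instance.

(** The system is found to be -c/2 times the polynomials P and R, and c/2 times Q.
    Comparison with 2 eta / b gives b = - eta c. *)
Lemma scaling_constants (k : fieldType) (e c : k) :
  2 != 0 :> k -> e != 0 -> c != 0 ->
  [/\ - (e * c) != 0, 2 * e / - (e * c) * - (c / 2) = 1
    & - (2 * e / - (e * c)) * (c / 2) = 1].
Proof.
move=> two0 e0 c0; have ec : - (e * c) != 0 by rewrite oppr_eq0 mulf_neq0.
by split=> //; field; rewrite two0.
Qed.

Lemma weighted_sum (k : fieldType) (b0 b1 b2 : k) :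
  2 != 0 :> k -> b0 + b1 + b2 = 2^-1 -> b0 + b2 + 2 * b1 + b0 + b2 = 1.
Proof.
move=> two0 sb; have -> : b0 + b2 + 2 * b1 + b0 + b2 = 2 * (b0 + b1 + b2) by ring.
by rewrite sb mulfV.
Qed.

Theorem theorem5p1 (R : realType) (eta beta0 beta1 beta2 : complex R)
    (f1 f2 f3 : Pxyz R)
    (heta : eta != 0)
    (hbeta : beta0 + beta1 + beta2 = 2^-1)
    (heta1 : eta != 1) (hetaN1 : eta != -1)
    (hbeta0 : beta0 != 0) (hbeta1 : beta1 != 0) (hbeta2 : beta2 != 0)
    (A1 : [/\ msize f1 = 7%N, msize f2 = 7%N & msize f3 = 7%N])
    (A2 : [/\ polynomial_in (vec3 f1 f2 f3) (chart1 eta beta0),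
              polynomial_in (vec3 f1 f2 f3) (chart2 beta1)
            & polynomial_in (vec3 f1 f2 f3) (chart3 beta2)]) :
  exists (b : Ct R) (a0 a1 a2 a3 a4 : complex R),
    [/\ a4 = a1, a0 = a3, beta0 = a3, beta1 = a2 & beta2 = a1] /\
    D4_system eta b a0 a1 a2 a3 a4 f1 f2 f3.
Proof.
have [s1 s2 s3] := A1; have [p1 p2 p3] := A2.
have deg i : (msize (vec3 f1 f2 f3 i) <= 7)%N.
  by move: i; apply: vec3_ind; rewrite /vec3 /tnth /= ?s1 ?s2 ?s3.
have [c [e1 e2 e3]] := system_up_to_scalar heta heta1 hetaN1 hbeta0 hbeta1 hbeta2
  hbeta deg p1 p2 p3.
rewrite /vec3 /tnth /= in e1 e2 e3.
have c0 : c != 0.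
  apply/eqP => c0; move: s1.
  by rewrite e1 c0 mul0r oppr0 scale0r msize0.
pose cT : {rmorphism complex R -> Ct R} := @tofrac {poly complex R} \o @polyC _.
have eta0 : constT eta != 0 by rewrite (fmorph_eq0 cT).
have two0 : 2 != 0 :> Ct R by rewrite (GRing.pcharf0P _).1 //; exact: pchar0_Ct.
have k2 : constT (2 * eta) = 2 * constT eta by rewrite -[LHS]/(cT _) rmorphM rmorph_nat.
have [b_neq0 kc kcN] := scaling_constants two0 eta0 c0.
exists (- (constT eta * c)), beta0, beta2, beta1, beta0, beta2.
split; first by split.
split.
  split; [exact: heta | exact: b_neq0 |].
  apply: weighted_sum hbeta; rewrite (GRing.pcharf0P _).1 //.
  exact: Num.Theory.pchar_num.
rewrite k2; split.
- by rewrite e1 scalerA kc scale1r.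
- by rewrite e2 scalerA kcN scale1r.
- by rewrite e3 scalerA kc scale1r.
Qed.
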